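(* Consider the bidimensional risk model $$U_i(t)=u_i+C_i(t)-\sum_{k=1}^{N(t)}X_{ik}+\sigma_i B_i(t),\quad t\ge 0,\ i=1,2$$ (interest rate $r=0$, both classes sharing the same claim-number process $N_1(t)=N_2(t)=N(t)$, a Poisson process with intensity $\lambda>0$), under the standing assumptions listed in the context. Assume that the correlation coefficient of $(B_1,B_2)$ satisfies $\rho\in(-1,0]$ and that $\{X_{1k},k\ge1\}$, $\{X_{2k},k\ge1\}$, $\{C_1(t),t\ge0\}$, $\{C_2(t),t\ge0\}$, $\{N(t),t\ge0\}$, $\{(B_1(t),B_2(t)),t\ge0\}$ are mutually independent. Let $F_1,F_2$ be the distribution functions of $X_{11}$ and $X_{21}$. (a) If $F_1,F_2\in\mathcal{S}$, then for each fixed $T>0$, as $(u_1,u_2)\to(\infty,\infty)$, $$\psi_{\max}(\vec u;T)\sim \lambda T(1+\lambda T)\,\overline{F_1}(u_1)\,\overline{F_2}(u_2),$$ $$\psi_{\min}(\vec u;T)\sim \lambda T\left(\overline{F_1}(u_1)+\overline{F_2}(u_2)\right).$$ (b) If $F_1*F_2\in\mathcal{S}$, then for each fixed $T>0$, as $u_1+u_2\to\infty$, $$\psi_{\rm sum}(\vec u;T)\sim \lambda T\left(\overline{F_1}(u_1+u_2)+\overline{F_2}(u_1+u_2)\right).$$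
   Context: Standing assumptions of the model: $\vec u=(u_1,u_2)$ is the initial surplus vector. The claim vectors $(X_{1k},X_{2k})$, $k=1,2,\dots$, are i.i.d. with nonnegative components. For $i=1,2$, $C_i$ (total premiums) is a nonnegative, nondecreasing, right-continuous stochastic process with $C_i(0)=0$. $(B_1,B_2)$ is a standard bidimensional Brownian motion (each component a standard one-dimensional Brownian motion, jointly Gaussian) with constant correlation coefficient $\rho$, i.e. $\mathrm{Cov}(B_1(s),B_2(t))=\rho\min\{s,t\}$. $\sigma_1,\sigma_2\ge0$ are constants. Safety loading (since $r=0$): $E C_i(t)-\lambda t\,E X_{i1}>0$ for all $t>0$, $i=1,2$. Ruin probabilities: with $\inf\emptyset=\infty$, put $T_{\max}=\inf\{t>0:\max\{U_1(t),U_2(t)\}<0\}$, $T_{\min}=\inf\{t>0:\min\{U_1(t),U_2(t)\}<0\}$, $T_{\rm sum}=\inf\{t>0:U_1(t)+U_2(t)<0\}$, and for $T>0$ define $\psi_{\max}(\vec u;T)=P(T_{\max}\le T\mid \vec U(0)=\vec u)$, $\psi_{\min}(\vec u;T)=P(T_{\min}\le T\mid \vec U(0)=\vec u)$, $\psi_{\rm sum}(\vec u;T)=P(T_{\rm sum}\le T\mid \vec U(0)=\vec u)$. Notation: $\overline F=1-F$; $F*G$ is the convolution and $F^{*n}$ the $n$-fold convolution of distributions; $a\sim b$ means $a/b\to1$ in the indicated limit. A distribution $F$ on the nonnegative half-line with $\overline F(x)>0$ for all $x$ is subexponential, $F\in\mathcal{S}$, if $\lim_{x\to\infty}\overline{F^{*n}}(x)/\overline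 F(x)=n$ for $n=2,3,\dots$. *)

(* Defs.v *)
From HB Require Import structures.
From mathcomp Require Export all_boot all_order all_algebra finmap.
From mathcomp Require Export all_classical all_reals all_analysis.

Set Implicit Arguments.
Unset Strict Implicit.
Unset Printing Implicit Defensive.

Export Order.TTheory GRing.Theory Num.Theory.
Export numFieldNormedType.Exports.

Local Open Scope classical_set_scope.
Local Open Scope ring_scope.

(** * Independence *)

Section independence.
Context {d : measure_display} {Omega : measurableType d} {R : realType}.
Variable P : probability Omega R.

Definition mutual_indep (I : choiceType) (G : I -> set_system Omega) : Prop :=
  forall (J : {fset I}) (A : I -> set Omega),
    (forall i, i \in J -> G i (A i)) ->
    P (\bigcap_(i in [set` J]) A i) = (\prod_(i <- J) fine (P (A i)))%:E.

Definition sigma_rv d' (T : measurableType d') (Y : Omega -> T) :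
    set_system Omega :=
  preimage_set_system setT Y measurable.

Definition sigma_process d' (T : measurableType d') (I : Type) (D : set I)
    (Y : I -> Omega -> T) : set_system Omega :=
  <<s \bigcup_(i in D) sigma_rv (Y i) >>.

Definition iid d' (T : measurableType d') (Y : nat -> Omega -> T) : Prop :=
  mutual_indep (fun k => sigma_rv (Y k)) /\
  forall (k : nat) (A : set T), measurable A ->
    P (Y k @^-1` A) = P (Y 0%N @^-1` A).

End independence.

(** * Stochastic processes indexed by [0, +oo[

    Processes are families over all of [R]; only the times [0 <= t] matter. *)

Section processes.
Context {d : measure_display} {Omega : measurableType d} {R : realType}.
Variable P : probability Omega R.

Definition right_continuous_paths (Y : R -> Omega -> R) : Prop :=
  forall omega t, 0 <= t -> Y s omega @[s --> t^'+] --> Y t omega.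

Definition nondecreasing_paths (Y : R -> Omega -> R) : Prop :=
  forall omega s t, 0 <= s -> s <= t -> Y s omega <= Y t omega.

(* Independence is over finite subfamilies and [t] may be eventually constant,
   so this covers every finite subdivision. *)
Definition independent_increments (Y : R -> Omega -> R) : Prop :=
  forall t : nat -> R, 0 <= t 0%N -> (forall k, t k <= t k.+1) ->
    mutual_indep P
      (fun k => sigma_rv (fun omega => Y (t k.+1) omega - Y (t k) omega)).

Definition poisson_process (lambda : R) (N : R -> {RV P >-> nat}) : Prop :=
  let NR := fun t omega => (N t omega)%:R : R in
  [/\ forall omega, N 0 omega = 0%N,
      nondecreasing_paths NR /\ right_continuous_paths NR,
      independent_increments NR &
      forall s t k, 0 <= s -> s < t ->
        P [set omega | N t omega = (N s omega + k)%N] =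
          (poisson_pmf (lambda * (t - s)) k)%:E].

Definition brownian_motion (B : R -> {RV P >-> R}) : Prop :=
  [/\ forall omega, B 0 omega = 0,
      forall omega, {within [set t | 0 <= t], continuous (fun t => B t omega)},
      independent_increments (fun t omega => B t omega) &
      forall s t (A : set R), 0 <= s -> s < t -> measurable A ->
        P [set omega | A (B t omega - B s omega)] =
          normal_prob 0 (Num.sqrt (t - s)) A].

(* [normal_prob m 0] is not the Dirac measure at [m], hence the case split:
   degenerate Gaussian laws have to be allowed here. *)
Definition gaussian (Y : Omega -> R) : Prop :=
  exists m s : R, 0 <= s /\ forall A : set R, measurable A ->
    P (Y @^-1` A) = if s == 0 then \d_m A else normal_prob m s A.

Definition jointly_gaussian (B1 B2 : R -> Omega -> R) : Prop :=
  forall (n : nat) (t a b : 'I_n -> R), (forall i, 0 <= t i) ->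
    gaussian (fun omega =>
      \sum_(i < n) (a i * B1 (t i) omega + b i * B2 (t i) omega)).

Definition brownian_motion2 (rho : R) (B1 B2 : R -> {RV P >-> R}) : Prop :=
  [/\ brownian_motion B1, brownian_motion B2,
      jointly_gaussian (fun t omega => B1 t omega) (fun t omega => B2 t omega) &
      forall s t, 0 <= s -> 0 <= t ->
        covariance P (B1 s) (B2 t) = (rho * Num.min s t)%:E].

Definition premium_process (C : R -> {RV P >-> R}) : Prop :=
  [/\ forall omega, C 0 omega = 0,
      forall omega t, 0 <= t -> 0 <= C t omega,
      nondecreasing_paths (fun t omega => C t omega) &
      right_continuous_paths (fun t omega => C t omega)].

(* Evaluated in [\bar R], where [+oo - +oo = -oo]: the condition forces
   [X] to be integrable when [lambda > 0] and [0 <= X]. *)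
Definition safety_loading (lambda : R) (C : R -> {RV P >-> R})
    (X : {RV P >-> R}) : Prop :=
  forall t, 0 < t -> (0 < 'E_P[C t] - (lambda * t)%:E * 'E_P[X])%E.

End processes.

(** * Distributions on the real line *)

Section convolution.
Context {R : realType}.

Definition add_pair (z : R * R) : R := z.1 + z.2.

Lemma measurable_add_pair : measurable_fun setT add_pair.
Proof. exact: measurable_realfun.measurable_funD. Qed.

HB.instance Definition _ :=
  isMeasurableFun.Build _ _ _ _ add_pair measurable_add_pair.

Definition convolution (F G : probability R R) : probability R R :=
  distribution (F \x G)%E add_pair.

Fixpoint conv_pow (F : probability R R) (n : nat) : probability R R :=
  if n is m.+1 then convolution (conv_pow F m) F else dirac (0 : R).

Definition dist_fun (F : probability R R) (x : R) : R := fine (F `]-oo, x]%classic).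

Definition tail (F : probability R R) (x : R) : R := 1 - dist_fun F x.

Definition subexponential (F : probability R R) : Prop :=
  [/\ F `]-oo, 0[%classic = 0%E,
      forall x, 0 < tail F x &
      forall n, (2 <= n)%N ->
        tail (conv_pow F n) x / tail F x @[x --> +oo] --> (n%:R : R)].

End convolution.

(** * The risk model *)

Section risk_model.
Context {d : measure_display} {Omega : measurableType d} {R : realType}.
Variable P : probability Omega R.

(* The claims are indexed from 0: [X k] is the claim number [k + 1]. *)
Definition surplus (u : R) (C : R -> Omega -> R) (X : nat -> Omega -> R)
    (N : R -> Omega -> nat) (sigma : R) (B : R -> Omega -> R)
    (t : R) (omega : Omega) : R :=
  u + C t omega - \sum_(k < N t omega) X k omega + sigma * B t omega.

(* [ereal_inf set0 = +oo] *)
Definition ruin_time (V : R -> Omega -> R) (omega : Omega) : \bar R :=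
  ereal_inf [set t%:E | t in [set t | 0 < t /\ V t omega < 0]].

Definition T_max (U1 U2 : R -> Omega -> R) : Omega -> \bar R :=
  ruin_time (fun t omega => Num.max (U1 t omega) (U2 t omega)).

Definition T_min (U1 U2 : R -> Omega -> R) : Omega -> \bar R :=
  ruin_time (fun t omega => Num.min (U1 t omega) (U2 t omega)).

Definition T_sum (U1 U2 : R -> Omega -> R) : Omega -> \bar R :=
  ruin_time (fun t omega => U1 t omega + U2 t omega).

(* Applied to surplus processes started from [u], which is deterministic:
   this is the probability given [U(0) = u]. *)
Definition ruin_prob (tau : Omega -> \bar R) (T : R) : R :=
  fine (P [set omega | (tau omega <= T%:E)%E]).

End risk_model.

(** * Asymptotics *)

Definition asymp_equiv {R : realType} {T : Type} (F : set_system T)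
    (f g : T -> R) : Prop :=
  f x / g x @[x --> F] --> (1 : R).

(* [(u1, u2) --> (+oo, +oo)] *)
Definition both_pinfty (R : realType) : set_system (R * R) :=
  filter_prod (pinfty_nbhs R) (pinfty_nbhs R).

(* [u1 + u2 --> +oo] *)
Definition sum_pinfty (R : realType) : set_system (R * R) :=
  filter_from setT (fun M : R => [set u | M < u.1 + u.2]).

Arguments both_pinfty R : clear implicits.
Arguments sum_pinfty R : clear implicits.

#[global] Instance both_pinfty_filter (R : realType) :
  ProperFilter (both_pinfty R).
Proof. exact: filter_prod_proper. Qed.

#[global] Instance sum_pinfty_filter (R : realType) :
  ProperFilter (sum_pinfty R).
Proof.
apply: filter_from_proper => [|M _].
  apply: filter_from_filter; first by exists 0.
  move=> M M' _ _; exists (Num.max M M') => // u /=.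
  by rewrite gt_max => /andP[].
by exists (M + 1, 0); rewrite /= addr0 ltrDl.
Qed.

(* Main.v *)
Require Import Defs.
From mathcomp Require Import all_boot all_order all_algebra finmap.
From mathcomp Require Import all_classical all_reals all_analysis.
From mathcomp Require Import measurable_realfun lra ring.

Set Implicit Arguments.
Unset Strict Implicit.
Unset Printing Implicit Defensive.

Import Order.TTheory GRing.Theory Num.Theory.
Import numFieldNormedType.Exports.

Local Open Scope classical_set_scope.
Local Open Scope ring_scope.

(** The theorem is an instance of the principle of a single big jump. Until time [T] the
    premiums and the Brownian motions contribute amounts that do not depend on the
    initial surplus. So ruin of line [i] until [T] is, up to a random shift of the level,
    the event [u_i < S_i (N T)], where [S_i n] is the sum of the first [n] claims of that
    line. Namely, ruin implies [u_i - (m_i * b_i + 1) < S_i (N T)] and is implied by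
    [u_i + (c_i + 1) + m_i * b_i < S_i (N T)]. Here [b_i] is an integer bounding the
    Brownian path on [[0, T]], [c_i] is the integer part of [C_i T], and [m_i] is an
    integer above [sigma_i] ([ruin_time_attained], [claims_ge_surplus],
    [surplus_le_claims]).

    These integers and [N T] form a discrete variable [V] that is independent of the
    claims. Given [V = v] the claims exceed the shifted level with probability
    [tail (conv_pow F n) (u + s v)], [n] being the value of [N T] ([iid_sum_law]). By
    [mixture], the exceedance probability divided by [tail F u] is therefore the mean of
    [shifted_ratio]. Each ratio tends to [n], because subexponential tails are insensitive
    to shifts of the level ([conv_pow_shift]). The limit passes under the mean by dominated
    convergence: the ratio is at most a constant times [r ^+ n * 2 ^+ b], [b] bounding the
    downward shift ([kesten_bound], [long_tail_geom]), and all exponential moments of [N T]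
    and of the [b_i] are finite. For the Poisson variable [N T] this is a computation; for
    [b_i] it follows from the Gaussian tails of the increments by chaining over dyadic
    times ([brownian_bound_exp_moment]). Products of powers are bounded by sums of squares,
    so the marginal moments of [b_1] and [b_2] suffice ([mul_le_sqrD]).

    For one line the limit is the mean [mu = lambda * T] of [N T]; for both lines at
    once, whose claims are independent given [V], it is the second moment
    [mu * (1 + mu)] ([random_sum_cvg], [random_sum2_cvg]). The latter is the assertion on
    simultaneous ruin. For the ruin of at least one line the joint exceedance is
    negligible, and the two single exceedances add up. The total surplus is a single
    line with claims of law [F1 * F2], to which the result for one line applies; it remains to see that the tail of
    a subexponential convolution is equivalent to the sum of the tails of its factors,
    which is [tail_convolution_equiv]. *)

(** * Probabilities as real numbers *)

Notation pr P A := (fine (P A%classic)).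

Section real_probability.
Context {d : measure_display} {T : measurableType d} {R : realType}.
Variable P : probability T R.
Implicit Types A B : set T.

Lemma prE A : measurable A -> P A = (pr P A)%:E.
Proof. by move=> mA; rewrite fineK// fin_num_measure. Qed.

Lemma pr_ge0 A : 0 <= pr P A.
Proof. exact: fine_ge0. Qed.

Lemma pr_le1 A : measurable A -> pr P A <= 1.
Proof. by move=> mA; rewrite -lee_fin -(prE mA) probability_le1. Qed.

Lemma prT : pr P setT = 1.
Proof. by rewrite probability_setT. Qed.

Lemma pr_mono A B : measurable A -> measurable B -> A `<=` B -> pr P A <= pr P B.
Proof.
by move=> mA mB AB; rewrite -lee_fin -(prE mA) -(prE mB) le_measure// inE.
Qed.

Lemma prU A B : measurable A -> measurable B -> A `&` B = set0 ->
  pr P (A `|` B) = pr P A + pr P B.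
Proof.
by move=> mA mB AB; rewrite measureU// fineD// fin_num_measure.
Qed.

Lemma pr_setDI A B : measurable A -> measurable B ->
  pr P A = pr P (A `\` B) + pr P (A `&` B).
Proof.
move=> mA mB; rewrite -prU ?setDKI//.
- by rewrite setUC setUIDK.
- exact: measurableD.
- exact: measurableI.
- by apply/seteqP; split => // x [[_ ?] []].
Qed.

Lemma prUI A B : measurable A -> measurable B ->
  pr P (A `|` B) = pr P A + pr P B - pr P (A `&` B).
Proof.
move=> mA mB; rewrite [pr P B](pr_setDI mB mA) [B `&` A]setIC addrA addrK -prU.
- by congr (pr P _); apply/seteqP; split=> x [|]; [left|case: (pselect (A x)); [left|right]|left|case=> ? ?; right].
- by [].
- exact: measurableD.
- by apply/seteqP; split => // x [? []].
Qed.

Lemma prUI_eq A B a b c : measurable A -> measurable B ->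
  pr P A = a -> pr P B = b -> pr P (A `&` B) = c -> pr P (A `|` B) = a + b - c.
Proof. by move=> mA mB <- <- <-; exact: prUI. Qed.

Lemma prU_disj_le A B C : measurable A -> measurable B -> measurable C ->
  A `&` B = set0 -> A `|` B `<=` C -> pr P A + pr P B <= pr P C.
Proof.
move=> mA mB mC AB ABC; rewrite -prU//; apply: pr_mono => //.
exact: measurableU.
Qed.

Lemma prU_le A B : measurable A -> measurable B ->
  pr P (A `|` B) <= pr P A + pr P B.
Proof. by move=> mA mB; rewrite prUI// gerBl pr_ge0. Qed.

End real_probability.

Arguments prE {d T R P A}.
Arguments pr_le1 {d T R P A}.
Arguments pr_ge0 {d T R P A}.

(** * Independence and laws of sums *)

Section independence_lemmas.
Context {d : measure_display} {T : measurableType d} {R : realType}.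
Variable P : probability T R.

Lemma sigma_rvP d' (U : measurableType d') (Y : T -> U) (A : set U) :
  measurable A -> sigma_rv Y (Y @^-1` A).
Proof. by move=> mA; exists A => //; rewrite setTI. Qed.

Lemma mutual_indep_sub (I : choiceType) (G H : I -> set_system T) :
  (forall i, G i `<=` H i) -> mutual_indep P H -> mutual_indep P G.
Proof. by move=> GH iH J A GA; apply: iH => i iJ; apply/GH/GA. Qed.

Lemma sigma_rv_comp d1 d2 (U : measurableType d1) (V : measurableType d2)
    (Y : T -> U) (f : U -> V) : measurable_fun setT f ->
  sigma_rv (f \o Y) `<=` sigma_rv Y.
Proof.
move=> mf _ [A mA <-]; rewrite setTI comp_preimage; apply: sigma_rvP.
by rewrite -[X in measurable X]setTI; exact: mf.
Qed.

Lemma prod_rect d1 d2 (U : measurableType d1) (V : measurableType d2)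
    (F : probability U R) (G : probability V R) (A : set U) (B : set V) :
  measurable A -> measurable B -> pr (F \x G)%E (A `*` B) = pr F A * pr G B.
Proof.
by move=> mA mB; rewrite product_measure1E// fineM// fin_num_measure.
Qed.

(** A finite measure on a product is determined by its values on rectangles; after
    division by [P E] this is the uniqueness of the product measure. The event [E]
    makes the lemma give conditional joint laws as well. *)
Lemma pair_law d1 d2 (U : measurableType d1) (V : measurableType d2)
    (Y : T -> U) (Z : T -> V) (mu : probability U R) (nu : probability V R)
    (E : set T) :
  measurable_fun setT Y -> measurable_fun setT Z -> measurable E ->
  (forall A B, measurable A -> measurable B ->
    P (Y @^-1` A `&` Z @^-1` B `&` E) = mu A * nu B * P E)%E ->
  forall C, measurable C ->
    P ((fun w => (Y w, Z w)) @^-1` C `&` E) = ((mu \x nu) C * P E)%E.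
Proof.
move=> mY mZ mE ind C mC.
have mYZ : measurable_fun setT (fun w => (Y w, Z w)).
  exact/measurable_fun_pair.
have mYZC : measurable ((fun w => (Y w, Z w)) @^-1` C).
  by rewrite -[X in measurable X]setTI; exact: mYZ.
have [PE0|PE0] := eqVneq (pr P E) 0.
  rewrite (prE mE) PE0 mule0; apply/eqP; rewrite eq_le measure_ge0 andbT.
  rewrite -[leRHS]/(0%:E) -PE0 -prE//; apply: le_measure; rewrite ?inE//.
  exact: measurableI.
have PEgt0 : 0 < pr P E by rewrite lt_neqAle eq_sym PE0 pr_ge0.
have PEV : 0 <= (pr P E)^-1 by rewrite invr_ge0 ltW.
pose r : {nonneg R} := NngNum PEV.
pose m' := mscale r (pushforward (mrestr P mE) (fun w => (Y w, Z w))).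
have -> : (mu \x nu)%E C = m' mYZ C.
  apply: product_measure_unique => // A B mA mB.
  transitivity ((pr P E)^-1%:E * P (Y @^-1` A `&` Z @^-1` B `&` E))%E => //.
  by rewrite ind// muleC -muleA (prE mE) -EFinM mulfV// mule1.
transitivity ((pr P E)^-1%:E * P ((fun w => (Y w, Z w)) @^-1` C `&` E) *
  P E)%E => //.
by rewrite muleAC {2}(prE mE) -EFinM mulVf// mul1e.
Qed.

Variables (Y : nat -> T -> R) (F : probability R R).
Hypothesis mY : forall k, measurable_fun setT (Y k).
Hypothesis Yindep : mutual_indep P (fun k => sigma_rv (Y k)).
Hypothesis YF : forall k A, measurable A -> P (Y k @^-1` A) = F A.

Let S n w := \sum_(k < n) Y k w.

Lemma measurable_iid_sum n : measurable_fun setT (S n).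
Proof. by apply: measurable_sum. Qed.

(** The law of the sum alone is too weak for the induction on [n], whose step needs
    the next variable to be independent of the sum: hence the event of later
    variables that is carried along. *)
Lemma iid_sum_indep n (J : {fset nat}) (A : set R) (B : nat -> set R) :
  measurable A -> (forall i, measurable (B i)) ->
  (forall i, i \in J -> (n <= i)%N) ->
  P (S n @^-1` A `&` \bigcap_(i in [set` J]) (Y i @^-1` B i)) =
  (conv_pow F n A * P (\bigcap_(i in [set` J]) (Y i @^-1` B i)))%E.
Proof.
have mYB (B' : nat -> set R) : (forall i, measurable (B' i)) ->
    forall i, measurable (Y i @^-1` B' i).
  by move=> mB' i; rewrite -[X in measurable X]setTI; exact: mY.
have mcap (B' : nat -> set R) (K : {fset nat}) :
    (forall i, measurable (B' i)) ->
    measurable (\bigcap_(i in [set` K]) (Y i @^-1` B' i)).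
  move=> mB'; apply: fin_bigcap_measurable => // i _; exact: mYB.
elim: n J A B => [|n IH] J A B mA mB Jn.
  have -> : S 0%N = cst 0 by apply/funext => w; rewrite /S big_ord0.
  rewrite preimage_cst /= diracE.
  by case: ifP => A0; rewrite ?setTI ?set0I ?measure0 (mul1e, mul0e).
set E := \bigcap_(i in _) _.
have nJ : n \notin J by apply/negP => /Jn; rewrite ltnn.
have step A' B' : measurable A' -> measurable B' ->
    P (S n @^-1` A' `&` Y n @^-1` B' `&` E) =
    (conv_pow F n A' * F B' * P E)%E.
  move=> mA' mB'.
  pose B2 i := if i == n then B' else B i.
  have mB2 i : measurable (B2 i) by rewrite /B2; case: ifP.
  have capE : \bigcap_(i in [set` (n |` J)%fset]) (Y i @^-1` B2 i) =
      Y n @^-1` B' `&` E.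
    apply/seteqP; split => w.
      move=> H; split=> [|i /= iJ].
        by have := H n; rewrite /= !inE eqxx /B2 eqxx; apply.
      have := H i; rewrite /= !inE iJ orbT /B2; case: eqP => [ein|_]; last exact.
      by move: iJ; rewrite ein (negbTE nJ).
    move=> [HB HE] i /=; rewrite !inE /B2 => /orP[/eqP ->|iJ].
      by rewrite eqxx.
    by case: eqP => [->//|_]; exact: HE.
  have capEP : P (\bigcap_(i in [set` (n |` J)%fset]) (Y i @^-1` B2 i)) =
      (F B' * P E)%E.
    rewrite Yindep; last by move=> i _; exact: sigma_rvP.
    rewrite /E Yindep; last by move=> i _; exact: sigma_rvP.
    rewrite big_fsetU1//= EFinM {1}/B2 eqxx -(prE (mYB _ (fun=> mB') n)) YF//.
    congr (_ * _%:E)%E; apply: eq_big_seq => i iJ; rewrite /B2.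
    by case: eqP => // ein; move: iJ; rewrite ein (negbTE nJ).
  rewrite -setIA -capE IH//; last first.
    by move=> i; rewrite !inE => /orP[/eqP->//|/Jn/ltnW].
  by rewrite capEP muleA.
have -> : S n.+1 @^-1` A =
    (fun w => (S n w, Y n w)) @^-1` (Defs.add_pair @^-1` A).
  by apply/seteqP; split => w; rewrite /= /S big_ord_recr.
rewrite (pair_law (mu := conv_pow F n) (nu := F))//.
- exact: measurable_iid_sum.
- exact: mcap.
- by rewrite -[X in measurable X]setTI; exact: measurable_funP.
Qed.

Lemma iid_sum_law n (A : set R) : measurable A ->
  P (S n @^-1` A) = conv_pow F n A.
Proof.
move=> mA; have := @iid_sum_indep n fset0 A (fun=> setT) mA.
rewrite set_fset0 bigcap_set0 setIT probability_setT mule1; apply=> //.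
Qed.

End independence_lemmas.

Arguments prod_rect {R d1 d2 U V F G A B}.

(** * Tails, convolutions and subexponential laws *)

Section tails.
Context {R : realType}.
Implicit Types F G H : probability R R.

Lemma tailE F x : tail F x = pr F `]x, +oo[.
Proof.
rewrite /tail /dist_fun -[1](prT F).
rewrite -(setvU `]-oo, x]%classic) setCitvl prU//.
- by rewrite addrK.
- by rewrite -setCitvl setICl.
Qed.

Lemma tail_ge0 F x : 0 <= tail F x.
Proof. by rewrite tailE pr_ge0. Qed.

Lemma tail_le1 F x : tail F x <= 1.
Proof. by rewrite tailE pr_le1. Qed.

Lemma tail_nonincreasing F x y : x <= y -> tail F y <= tail F x.
Proof.
move=> xy; rewrite !tailE; apply: pr_mono => //.
by apply: subset_itvr; rewrite bnd_simp.
Qed.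

Lemma tail_neg F x : F `]-oo, 0[%classic = 0%E -> x < 0 -> tail F x = 1.
Proof.
move=> F0 x0; rewrite /tail /dist_fun; suff -> : F `]-oo, x]%classic = 0%E by rewrite subr0.
apply/eqP; rewrite eq_le measure_ge0 andbT -F0 le_measure ?inE//.
by apply: subset_itvl; rewrite bnd_simp.
Qed.

Lemma pr_ge0_itv F : F `]-oo, 0[%classic = 0%E -> pr F `[0, +oo[ = 1.
Proof.
move=> F0; rewrite -[RHS](prT F) -(setvU `]-oo, 0[%classic) setCitvl prU//.
- by rewrite F0 addr0.
- by rewrite -setCitvl setICl.
Qed.

Lemma pr_itv F x y : x <= y -> pr F `]x, y] = tail F x - tail F y.
Proof.
move=> xy; rewrite !tailE (@pr_setDI _ _ _ F `]x, +oo[ `]y, +oo[)//.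
rewrite (_ : `]x, +oo[ `&` `]y, +oo[ = `]y, +oo[%classic); last first.
  apply/seteqP; split => z /=; rewrite !in_itv/= !andbT; first by case.
  by move=> yz; split => //; exact: le_lt_trans yz.
rewrite addrK; congr (pr F _); apply/seteqP; split => z /=; rewrite !in_itv/= !andbT.
  by move=> /andP[-> zy]; split => //; apply/negP; rewrite -leNgt.
by move=> [-> /negP]; rewrite -leNgt.
Qed.

Lemma tail_cvg0 F : tail F x @[x --> +oo] --> 0.
Proof.
have mid : measurable_fun setT (@idfun R) by exact: measurable_id.
pose X : {RV F >-> R} := mfun_Sub (mem_set mid).
have := cvg_ccdfy0 X => /fine_cvgP[_]; apply: cvg_trans; apply: near_eq_cvg.
by apply: nearW => x /=; rewrite tailE.
Qed.

Definition sum_above (x : R) : set (R * R) := [set z | x < z.1 + z.2].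

Lemma sum_aboveE x : sum_above x = Defs.add_pair @^-1` `]x, +oo[.
Proof. by apply/seteqP; split => z /=; rewrite in_itv/= andbT. Qed.

Lemma measurable_sum_above x : measurable (sum_above x).
Proof.
rewrite sum_aboveE -[X in measurable X]setTI; exact: measurable_funP.
Qed.

Lemma tail_convolution F G x :
  tail (convolution F G) x = pr (F \x G)%E (sum_above x).
Proof. by rewrite tailE sum_aboveE. Qed.

Lemma convolution2E F G (A : set R) : measurable A ->
  convolution F G A = (\int[G]_y F [set x | A (x + y)%R])%E.
Proof.
move=> mA; rewrite /convolution /distribution /pushforward.
have mC : measurable (Defs.add_pair (R:=R) @^-1` A).
  by rewrite -[X in measurable X]setTI; exact: measurable_funP.
transitivity ((F \x^ G)%E (Defs.add_pair (R:=R) @^-1` A)).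
  by apply: product_measure_unique => //= B1 B2 mB1 mB2; rewrite product_measure2E.
apply: eq_integral => y _ /=; congr (F _); apply/seteqP; split => x /=.
  by rewrite /ysection /= inE.
by rewrite /ysection /= inE.
Qed.

Lemma tail_convolution2 F G x :
  (tail (convolution F G) x)%:E = (\int[G]_y (tail F (x - y)%R)%:E)%E.
Proof.
rewrite tailE -(prE (measurable_itv _)) convolution2E//; apply: eq_integral => y _.
rewrite tailE -(prE (measurable_itv _)); congr (F _); apply/seteqP.
by split => z /=; rewrite !in_itv/= !andbT ltrBlDr.
Qed.

Lemma measurable_tail F : measurable_fun setT (tail F).
Proof. by apply: nonincreasing_measurable => // x y; exact: tail_nonincreasing. Qed.

(** Conditionally on the second summand, the tail of the sum is a shifted tail of the
    first one. *)
Lemma tail_convolution_le F F' G a : 0 <= a ->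
  (forall x, tail F x <= a * tail F' x) ->
  forall x, tail (convolution F G) x <= a * tail (convolution F' G) x.
Proof.
move=> a0 FF' x; rewrite -lee_fin EFinM !tail_convolution2.
have mt H : measurable_fun setT (fun y : R => (tail H (x - y))%:E).
  apply/measurable_EFinP/measurableT_comp; first exact: measurable_tail.
  exact: measurable_funB.
rewrite -ge0_integralZl//; last by move=> y _; rewrite lee_fin tail_ge0.
apply: ge0_le_integral => //.
- by move=> y _; rewrite lee_fin tail_ge0.
- by apply: measurable_funeM; exact: mt.
- by move=> y _; rewrite -EFinM lee_fin.
Qed.

Lemma conv_pow1 F A : measurable A -> conv_pow F 1 A = F A.
Proof.
move=> mA; rewrite -[LHS]/(convolution (conv_pow F 0) F A) convolution2E//=.
under eq_integral => y _ do rewrite diracE.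
transitivity (\int[F]_y (\1_A y)%:E)%E; last by rewrite integral_indic// setIT.
apply: eq_integral => y _; rewrite indicE; congr ((nat_of_bool _)%:R%:E).
by apply/idP/idP; rewrite !inE /= add0r.
Qed.

Lemma tail_conv_pow0 F x : tail (conv_pow F 0) x = (nat_of_bool (x < 0)%R)%:R.
Proof. by rewrite tailE /= /dirac indicE /= mem_setE in_itv/= andbT. Qed.

Lemma tail_conv_pow1 F x : tail (conv_pow F 1) x = tail F x.
Proof. by rewrite !tailE conv_pow1. Qed.

Lemma tail_conv_pow2 F x : tail (conv_pow F 2) x = tail (convolution F F) x.
Proof.
apply/eqP; rewrite eq_le; apply/andP; split.
  rewrite -[leRHS]mul1r; apply: tail_convolution_le => // y.
  by rewrite mul1r tail_conv_pow1.
rewrite -[leRHS]mul1r; apply: tail_convolution_le => // y.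
by rewrite mul1r tail_conv_pow1.
Qed.

(** Replacing one convolution square after the other by a single factor costs [c]
    each time, because [c] does not depend on the level. *)
Lemma tail_conv_pow_le F c : F `]-oo, 0[%classic = 0%E -> 0 <= c ->
  (forall x, tail (convolution F F) x <= c * tail F x) ->
  forall n x, tail (conv_pow F n) x <= c ^+ n * tail F x.
Proof.
move=> F0 c0 Fc; elim=> [|n IH] x.
  rewrite tail_conv_pow0 expr0 mul1r; case: (ltP x 0) => x0; last exact: tail_ge0.
  by rewrite tail_neg.
rewrite exprSr -mulrA; apply: (le_trans (tail_convolution_le F _ IH x)).
  exact: exprn_ge0.
by apply: ler_wpM2l => //; exact: exprn_ge0.
Qed.

End tails.

(** * Shifted levels and powers of a subexponential law *)

Section long_tails.
Context {R : realType}.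
Implicit Types F G : probability R R.

Lemma pr_itv0 F a : F `]-oo, 0[%classic = 0%E -> 0 <= a ->
  pr F `[0, a] = 1 - tail F a.
Proof.
move=> F0 a0; rewrite -(pr_ge0_itv F0) tailE.
rewrite (@pr_setDI _ _ _ F `[0, +oo[ `]a, +oo[)//.
rewrite (_ : `[0, +oo[ `&` `]a, +oo[ = `]a, +oo[%classic); last first.
  apply/seteqP; split => z /=; rewrite !in_itv/= !andbT; first by case.
  by move=> yz; split => //; exact: (le_trans a0 (ltW yz)).
rewrite addrK; congr (pr F _); apply/seteqP; split => z /=; rewrite !in_itv/= !andbT.
  by move=> /andP[-> zy]; split => //; apply/negP; rewrite -leNgt.
by move=> [-> /negP]; rewrite -leNgt.
Qed.

(** The three terms are disjoint ways of exceeding [x]: the second summand does it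
    by itself, the first one does it while the second is at most [a], or the second lies
    in [(a, x]] and leaves only [x - a] to the first. The last one brings in the
    shifted tail. *)
Lemma tail_convolution_ge F a x : F `]-oo, 0[%classic = 0%E -> 0 <= a -> a <= x ->
  tail F x + tail F x * (1 - tail F a) +
    tail F (x - a) * (tail F a - tail F x) <= tail (convolution F F) x.
Proof.
move=> F0 a0 ax; rewrite tail_convolution.
set Q := (F \x F)%E.
pose R1 : set (R * R) := `[0, +oo[%classic `*` `]x, +oo[%classic.
pose R2 : set (R * R) := `]x, +oo[%classic `*` `[0, a]%classic.
pose R3 : set (R * R) := `](x - a), +oo[%classic `*` `]a, x]%classic.
have m1 : measurable R1 by exact: measurableX.
have m2 : measurable R2 by exact: measurableX.
have m3 : measurable R3 by exact: measurableX.
have -> : tail F x = pr Q R1 by rewrite prod_rect// pr_ge0_itv// mul1r tailE.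
have -> : pr Q R1 * (1 - tail F a) = pr Q R2.
  by rewrite !prod_rect// pr_ge0_itv// mul1r pr_itv0.
have -> : tail F (x - a) * (tail F a - pr Q R1) = pr Q R3.
  by rewrite !prod_rect// pr_ge0_itv// mul1r pr_itv// !tailE.
rewrite -prU//; last first.
  apply/seteqP; split => // -[z1 z2] [[/= _ +] [/= _ +]] /=; rewrite !in_itv/= andbT.
  by move=> xz /andP[_ za]; move: (lt_le_trans xz za); rewrite ltNge ax.
rewrite -prU//; last first.
- apply/seteqP; split => // -[z1 z2] [+ [/= _ +]] /=; rewrite !in_itv/= => + /andP[az zx].
  move=> [[_]|[_]]; rewrite /= in_itv/= ?andbT; first by rewrite ltNge zx.
  by move=> /andP[_]; rewrite leNgt az.
- exact: measurableU.
apply: pr_mono; [by do !apply: measurableU|exact: measurable_sum_above|].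
move=> -[z1 z2] [[[]|[]]|[]]; rewrite /= !in_itv/= ?andbT /sum_above /=; lra.
Qed.

(** [tail_convolution_ge], divided by [tail F x] and solved for the shifted tail,
    bounds the ratio by a quantity that tends to [(2 - 2 + tail F a) / tail F a = 1],
    the first [2] being the limit that defines subexponentiality. *)
Lemma long_tail_sub F a : subexponential F -> 0 <= a ->
  tail F (x - a) / tail F x @[x --> +oo] --> (1 : R).
Proof.
move=> [F0 Fpos Fsub] a0.
have h2 : tail (convolution F F) x / tail F x @[x --> +oo] --> (2 : R).
  have := Fsub 2%N isT; apply: cvg_trans; apply: near_eq_cvg; apply: nearW => x.
  by rewrite tail_conv_pow2.
have ha : tail F a - tail F x @[x --> +oo] --> tail F a - 0.
  by apply: cvgB; [exact: cvg_cst|exact: tail_cvg0].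
rewrite subr0 in ha.
apply: (@squeeze_cvgr _ _ _ _ (fun=> 1) (fun x =>
  (tail (convolution F F) x / tail F x - 2 + tail F a) / (tail F a - tail F x))).
- near=> x.
  have tx : 0 < tail F x := Fpos x.
  have dx : 0 < tail F a - tail F x.
    by near: x; apply: (cvgr_gt _ ha); exact: Fpos.
  apply/andP; split.
    by rewrite ler_pdivlMr// mul1r; apply: tail_nonincreasing; rewrite gerBl.
  rewrite ler_pdivlMr//.
  rewrite mulrAC ler_pdivrMr//.
  have -> : (tail (convolution F F) x / tail F x - 2 + tail F a) * tail F x =
      tail (convolution F F) x - 2 * tail F x + tail F a * tail F x.
    by field; rewrite gt_eqF.
  have /(tail_convolution_ge F0 a0) : a <= x by near: x; apply: nbhs_pinfty_ge; rewrite num_real.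
  lra.
- exact: cvg_cst.
- rewrite -[X in _ --> X](_ : (2 - 2 + tail F a) / tail F a = 1); last first.
    by rewrite subrr add0r divff// gt_eqF.
  apply: cvgM; first by apply: cvgD; [apply: cvgB => //|]; exact: cvg_cst.
  by apply: cvgV => //; rewrite gt_eqF.
Unshelve. all: by end_near. Qed.

Lemma long_tail F c : subexponential F ->
  tail F (x + c) / tail F x @[x --> +oo] --> (1 : R).
Proof.
move=> hF; have [c0|c0] := leP c 0.
  by rewrite -[c]opprK; apply: long_tail_sub => //; rewrite oppr_ge0.
have := long_tail_sub hF (ltW c0) => h.
have h2 : tail F (x + c - c) / tail F (x + c) @[x --> +oo] --> (1 : R).
  exact: (cvg_comp _ _ (cvg_addrr c) h).
have h3 : (tail F (x + c - c) / tail F (x + c))^-1 @[x --> +oo] --> (1 : R).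
  by rewrite -[1]invr1; apply: cvgV.
apply: cvg_trans h3.
by apply: near_eq_cvg; apply: nearW => x; rewrite addrK invf_div.
Qed.

Lemma conv_pow_shift F n c : subexponential F ->
  tail (conv_pow F n) (x + c) / tail F x @[x --> +oo] --> (n%:R : R).
Proof.
move=> hF; have [F0 Fpos Fsub] := hF.
have h n' : tail (conv_pow F n') x / tail F x @[x --> +oo] --> (n'%:R : R).
  case: n' => [|[|n']]; last exact: Fsub.
    rewrite [X in _ --> X](_ : _ = 0)//; apply: cvg_near_cst; near=> x.
    have x0 : 0 <= x by near: x; apply: nbhs_pinfty_ge; rewrite num_real.
    by rewrite tail_conv_pow0 ltNge x0 mul0r.
  rewrite [X in _ --> X](_ : _ = 1)//; apply: cvg_near_cst; near=> x.
  by rewrite tail_conv_pow1 divff// gt_eqF.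
rewrite -[X in _ --> X]mulr1.
apply: (cvg_trans _ (cvgM (cvg_comp _ _ (cvg_addrr c) (h n)) (long_tail c hF))).
apply: near_eq_cvg; apply: nearW => x /=.
by rewrite mulrA divfK// gt_eqF.
Unshelve. all: by end_near. Qed.

(** Above some level the tail of the square is at most [3] times the tail; below that
    level the tail stays away from [0], so a larger constant serves all levels and
    [tail_conv_pow_le] applies. Such a crude base is enough for claim numbers all of
    whose exponential moments are finite. *)
Lemma kesten_bound F : subexponential F ->
  exists2 r, 1 <= r & forall n x, tail (conv_pow F n) x <= r ^+ n * tail F x.
Proof.
move=> [F0 Fpos Fsub].
have [M [_ hM]] : \forall x \near +oo, tail (conv_pow F 2) x / tail F x < 3.
  by apply: (cvgr_lt _ (Fsub 2%N isT)); rewrite ltr_nat.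
pose r := Num.max 3 (tail F (M + 1))^-1.
have r3 : 3 <= r by rewrite le_max lexx.
exists r; first by apply: le_trans r3; rewrite ler1n.
apply: tail_conv_pow_le => //; first exact: le_trans r3.
move=> x; rewrite -tail_conv_pow2; have [xM|Mx] := leP x (M + 1).
  apply: (le_trans (tail_le1 _ _)).
  rewrite -(mulVf (x := tail F (M + 1))) ?gt_eqF//.
  apply: ler_pM; rewrite ?invr_ge0 ?tail_ge0 ?le_max ?lexx ?orbT//.
  exact: tail_nonincreasing.
have {}Mx : M < x by apply: lt_trans Mx; rewrite ltrDl.
have := hM x Mx; rewrite ltr_pdivrMr// => /ltW/le_trans; apply.
by rewrite ler_pM2r.
Qed.

(** A unit shift costs a factor [th] above some level [M], by [long_tail]; below it
    the tail is at least [tail F (M + 1)], and the constant absorbs its inverse. *)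
Lemma long_tail_geom F th : subexponential F -> 1 < th ->
  exists2 c, 0 <= c & forall (j : nat) x, tail F (x - j%:R) <= c * th ^+ j * tail F x.
Proof.
move=> hF th1; have [F0 Fpos _] := hF.
have [M [_ hM]] : \forall x \near +oo, tail F (x - 1) / tail F x < th.
  exact: (cvgr_lt _ (long_tail (-1) hF)).
have tM := Fpos (M + 1).
exists (tail F (M + 1))^-1; first by rewrite invr_ge0 ltW.
elim=> [|j IH] x.
  rewrite subr0 expr0 mulr1 ler_peMl ?tail_ge0// -[leLHS](mulVf (x := tail F (M + 1))) ?gt_eqF//.
  by rewrite ler_piMr ?invr_ge0 ?tail_le1// ltW.
have [xM|Mx] := leP x (M + 1).
  apply: (le_trans (tail_le1 _ _)); rewrite -[leLHS](mulVf (x := tail F (M + 1))) ?gt_eqF//.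
  apply: ler_pM; rewrite ?invr_ge0 ?tail_ge0//; last exact: tail_nonincreasing.
  by rewrite ler_peMr ?invr_ge0 ?tail_ge0// exprn_ege1// ltW.
rewrite -addn1 natrD opprD addrCA addrC; apply: (le_trans (IH _)).
rewrite addn1 exprSr mulrA -[leRHS]mulrA ler_wpM2l//.
  by rewrite mulr_ge0 ?invr_ge0 ?tail_ge0// exprn_ge0// ltW// (lt_trans _ th1).
rewrite -ler_pdivrMr// ltW// hM//.
by apply: lt_trans Mx; rewrite ltrDl.
Qed.

End long_tails.

(** * The factors of a subexponential convolution *)

Lemma add_le_sub_sqr (R : realFieldType) (a b c t h : R) :
  a = b -> c = h + h - h ^+ 2 -> a + c <= t -> b <= t - 2 * h + h ^+ 2.
Proof. by move=> -> ->; lra. Qed.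

Lemma lower_bound_mul (R : realFieldType) (p q t h : R) : 0 < h ->
  (1 - (4 * (p / h - q / h) + 4 * (t / h - 2 + h))) * h =
  h - (4 * (p - q) + 4 * (t - 2 * h + h ^+ 2)).
Proof. by move=> h0; field; rewrite gt_eqF. Qed.

(** In the application [h] is the tail of the convolution, [a] and [b] are shifted tails
    of the factors and [a'], [b'] the unshifted ones, [c] is the cross probability. *)
Lemma lower_bound_arith (R : realFieldType) (a b a' b' c u t h : R) :
  a - a' <= 2 * t -> b - b' <= 2 * t -> c <= 4 * u -> h <= a + b + c ->
  h - (4 * t + 4 * u) <= a' + b'.
Proof. by lra. Qed.

Lemma half_bound (R : realFieldType) (p q t : R) :
  0 <= p -> q <= 2^-1 -> p * (1 - q) <= t -> p <= 2 * t.
Proof. by move=> p0 q2 pt; nra. Qed.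

Section convolution_factors.
Context {R : realType}.
Variables F1 F2 : probability R R.
Hypothesis F1_ge0 : F1 `]-oo, 0[%classic = 0%E.
Hypothesis F2_ge0 : F2 `]-oo, 0[%classic = 0%E.
Let H := convolution F1 F2.
Hypothesis Hsub : subexponential H.

Let Q : probability (R * R)%type R := (F1 \x F2)%E.

Let measurable_above_itv (i : interval R) :
  measurable (Defs.add_pair (R:=R) @^-1` [set` i]).
Proof. by rewrite -[X in measurable X]setTI; exact: measurable_funP. Qed.

Let tailHE x : tail H x = pr Q (sum_above x).
Proof. exact: tail_convolution. Qed.

Let tail_le1f x : 0 <= x -> tail F1 x <= tail H x.
Proof.
move=> x0; rewrite tailHE.
have <- : pr Q (`]x, +oo[%classic `*` `[0, +oo[%classic) = tail F1 x.
  by rewrite prod_rect// (pr_ge0_itv F2_ge0) mulr1 tailE.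
apply: pr_mono; [exact: measurableX|exact: measurable_sum_above|].
move=> [z1 z2] []; rewrite /= !in_itv/= !andbT /sum_above /=; lra.
Qed.

Let tail_ge x : 0 <= x ->
  tail F1 x + tail F2 x - tail F1 x * tail F2 x <= tail H x.
Proof.
move=> x0; rewrite tailHE.
pose R1 : set (R * R) := `]x, +oo[%classic `*` `[0, +oo[%classic.
pose R2 : set (R * R) := `[0, +oo[%classic `*` `]x, +oo[%classic.
have m1 : measurable R1 by exact: measurableX.
have m2 : measurable R2 by exact: measurableX.
have e1 : tail F1 x = pr Q R1.
  by rewrite prod_rect// (pr_ge0_itv F2_ge0) mulr1 tailE.
have e2 : tail F2 x = pr Q R2.
  by rewrite prod_rect// (pr_ge0_itv F1_ge0) mul1r tailE.
have e3 : tail F1 x * tail F2 x = pr Q (R1 `&` R2).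
  rewrite (_ : R1 `&` R2 = `]x, +oo[%classic `*` `]x, +oo[%classic).
    by rewrite prod_rect// !tailE.
  apply/seteqP; split => -[z1 z2].
    by move=> [[? _] [_ ?]].
  move=> [xz1 xz2]; split; split => //; rewrite /= in_itv/= andbT.
    by move: xz2; rewrite /= in_itv/= andbT => /ltW; exact: le_trans.
  by move: xz1; rewrite /= in_itv/= andbT => /ltW; exact: le_trans.
rewrite e3 e1 e2 -prUI//.
apply: pr_mono; [exact: measurableU|exact: measurable_sum_above|].
by move=> [z1 z2] [[]|[]]; rewrite /= !in_itv/= !andbT /sum_above /=; lra.
Qed.

Let cross (K x : R) : set (R * R) :=
  sum_above x `&` `]-oo, (x - K)]%classic `*` `]-oo, (x - K)]%classic.

Let measurable_cross K x : measurable (cross K x).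
Proof. by apply: measurableI; [exact: measurable_sum_above|exact: measurableX]. Qed.

Let tail_le K x : tail H x <= tail F1 (x - K) + tail F2 (x - K) + pr Q (cross K x).
Proof.
have -> : tail F1 (x - K) = pr Q (`](x - K), +oo[%classic `*` setT).
  by rewrite prod_rect// prT mulr1 tailE.
have -> : tail F2 (x - K) = pr Q (setT `*` `](x - K), +oo[%classic).
  by rewrite prod_rect// prT mul1r tailE.
have m1 : measurable (`](x - K), +oo[%classic `*` [set: R]) by exact: measurableX.
have m2 : measurable ([set: R] `*` `](x - K), +oo[%classic) by exact: measurableX.
rewrite tailHE.
apply: le_trans (lerD (prU_le Q m1 m2) (lexx _)).
apply: le_trans (prU_le Q (measurableU _ _ m1 m2) (measurable_cross K x)).
apply: pr_mono; first exact: measurable_sum_above.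
  by apply: measurableU => //; exact: measurableU.
move=> [z1 z2] xz; have [l1|l1] := leP z1 (x - K); last first.
  by left; left; split => //=; rewrite in_itv/= l1.
have [l2|l2] := leP z2 (x - K); last first.
  by left; right; split => //=; rewrite in_itv/= l2.
by right; split => //; split; rewrite /= in_itv/=.
Qed.

(** A first summand in [(x - K, x]] and a second one in [[0, K]] add up to a point of
    [(x - K, x + K]]: so increments of the tails of the factors are controlled by
    increments of [tail H], which is long-tailed. *)
Let shift1 K x : 0 <= K ->
  (tail F1 (x - K) - tail F1 x) * (1 - tail F2 K) <= tail H (x - K) - tail H (x + K).
Proof.
move=> K0; rewrite -pr_itv0// -pr_itv; last by rewrite gerBl.
rewrite -prod_rect// -pr_itv; last by lra.
rewrite -[X in _ <= X]/(pr Q (Defs.add_pair (R:=R) @^-1` `]x - K, x + K]%classic)).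
apply: pr_mono; [exact: measurableX|exact: measurable_above_itv|].
move=> [z1 z2] []; rewrite /= !in_itv/= /Defs.add_pair /= => /andP[a1 a2] /andP[b1 b2].
by apply/andP; split; lra.
Qed.

Let shift2 K x : 0 <= K ->
  (tail F2 (x - K) - tail F2 x) * (1 - tail F1 K) <= tail H (x - K) - tail H (x + K).
Proof.
move=> K0; rewrite -pr_itv0// -pr_itv; last by rewrite gerBl.
rewrite mulrC -prod_rect// -pr_itv; last by lra.
rewrite -[X in _ <= X]/(pr Q (Defs.add_pair (R:=R) @^-1` `]x - K, x + K]%classic)).
apply: pr_mono; [exact: measurableX|exact: measurable_above_itv|].
move=> [z1 z2] []; rewrite /= !in_itv/= /Defs.add_pair /= => /andP[a1 a2] /andP[b1 b2].
by apply/andP; split; lra.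
Qed.

Let Q4 : probability ((R * R) * (R * R))%type R := (Q \x Q)%E.

Let tail_HH x : tail (convolution H H) x =
  pr Q4 [set z | x < (z.1.1 + z.1.2) + (z.2.1 + z.2.2)].
Proof.
rewrite tail_convolution; pose s (i : bool) (z : (R * R) * (R * R)) :=
  if i then z.1.1 + z.1.2 else z.2.1 + z.2.2.
have mf : measurable_fun setT (Defs.add_pair (R:=R)) by exact: measurable_funP.
have := @pair_law _ _ _ Q4 _ _ _ _ (s true) (s false) H H setT.
move=> /(_ _ _ _ _ _ (measurable_sum_above x)).
rewrite setIT probability_setT mule1 => <- //.
- exact: (measurableT_comp mf (@measurable_fst _ _ _ _)).
- exact: (measurableT_comp mf (@measurable_snd _ _ _ _)).
- move=> A B mA mB; rewrite setIT mule1.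
  transitivity ((Q \x Q)%E ((Defs.add_pair (R:=R) @^-1` A) `*`
    (Defs.add_pair (R:=R) @^-1` B))) => //.
  by rewrite product_measure1E// -[X in measurable X]setTI; exact: mf.
Qed.

Let s1 (z : (R * R) * (R * R)) : R := z.1.1 + z.1.2.
Let s2 (z : (R * R) * (R * R)) : R := z.2.1 + z.2.2.

Let Q4_rect (A B : set R) : measurable A -> measurable B ->
  pr Q4 (s1 @^-1` A `&` s2 @^-1` B) =
  pr H A * pr H B.
Proof.
move=> mA mB; rewrite -[pr H A]/(pr Q (Defs.add_pair (R:=R) @^-1` A)).
rewrite -[pr H B]/(pr Q (Defs.add_pair (R:=R) @^-1` B)).
by rewrite -prod_rect// -[X in measurable X]setTI; exact: measurable_funP.
Qed.

(** Let [X], [X'] have law [F1] and [Y], [Y'] law [F2], all independent. When [Y] and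
    [X'] lie in [[0, K]] and [(X, Y')] in the cross event, neither [X + Y] nor
    [X' + Y'] exceeds [x] but their total does. This adds to the probability
    [2 tail H x - tail H x ^+ 2] that at least one of the two pairs exceeds [x], and
    subexponentiality of [H] leaves room for [o(tail H x)] only. *)
Let cross_le K x : 0 <= K -> 0 <= x ->
  (1 - tail F1 K) * (1 - tail F2 K) * pr Q (cross K x) <=
  tail (convolution H H) x - 2 * tail H x + tail H x ^+ 2.
Proof.
move=> K0 x0; have [H0 Hpos _] := Hsub.
pose E : set ((R * R) * (R * R)) := (setT `*` `[0, K]%classic) `*` (`[0, K]%classic `*` setT).
have mE : measurable E by apply: measurableX; apply: measurableX.
have EP : pr Q4 E = (1 - tail F1 K) * (1 - tail F2 K).
  rewrite prod_rect; [|exact: measurableX|exact: measurableX].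
  by rewrite !prod_rect// !prT mulr1 mul1r !pr_itv0// mulrC.
pose C : set ((R * R) * (R * R)) := (fun z => (z.1.1, z.2.2)) @^-1` cross K x `&` E.
have m11 : measurable_fun setT (fun z : (R * R) * (R * R) => z.1.1).
  exact: (measurableT_comp measurable_fst measurable_fst).
have m22 : measurable_fun setT (fun z : (R * R) * (R * R) => z.2.2).
  exact: (measurableT_comp measurable_snd measurable_snd).
have m12 : measurable_fun setT (fun z : (R * R) * (R * R) => z.1.2).
  exact: (measurableT_comp measurable_snd measurable_fst).
have m21 : measurable_fun setT (fun z : (R * R) * (R * R) => z.2.1).
  exact: (measurableT_comp measurable_fst measurable_snd).
have CP : pr Q4 C = (1 - tail F1 K) * (1 - tail F2 K) * pr Q (cross K x).
  rewrite (pair_law (mu := F1) (nu := F2))//.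
    have mc := measurable_cross K x.
    transitivity (pr Q (cross K x) * pr Q4 E); last by rewrite EP mulrC.
    transitivity (fine (Q (cross K x) * Q4 E)%E) => //.
    by rewrite (prE mc) (prE mE).
  move=> A B mA mB; transitivity (Q4 ((A `*` `[0, K]%classic) `*` (`[0, K]%classic `*` B))).
    congr (Q4 _); apply/seteqP; split => -[[a b] [c e]].
      by move=> [[/= ? ?] [[/= _ ?] [/= ? _]]].
    by move=> [[/= ? ?] [/= ? ?]].
  rewrite (prE mE) EP (prE mA) (prE mB) -!EFinM.
  have mAK : measurable (A `*` `[0, K]%classic) by exact: measurableX.
  have mKB : measurable (`[0, K]%classic `*` B) by exact: measurableX.
  have mABK : measurable ((A `*` `[0, K]%classic) `*` (`[0, K]%classic `*` B)).
    exact: measurableX.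
  rewrite (prE mABK) !prod_rect// !pr_itv0//.
  by congr (_%:E); ring.
pose A1 := s1 @^-1` `]x, +oo[ `&` s2 @^-1` `[0, +oo[.
pose A2 := s1 @^-1` `[0, +oo[ `&` s2 @^-1` `]x, +oo[.
have ms1 : measurable_fun setT s1 by exact: measurable_funD.
have ms2 : measurable_fun setT s2 by exact: measurable_funD.
have mpre (s : (R * R) * (R * R) -> R) (i : interval R) :
    measurable_fun setT s -> measurable (s @^-1` [set` i]).
  by move=> ms; rewrite -[X in measurable X]setTI; exact: ms.
have mA1 : measurable A1 by apply: measurableI; exact: mpre.
have mA2 : measurable A2 by apply: measurableI; exact: mpre.
have mC : measurable C.
  apply: measurableI => //; rewrite -[X in measurable X]setTI.
  by apply: measurable_fun_pair.
have A1P : pr Q4 A1 = tail H x by rewrite Q4_rect// pr_ge0_itv// mulr1 tailE.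
have A2P : pr Q4 A2 = tail H x by rewrite Q4_rect// pr_ge0_itv// mul1r tailE.
have A12P : pr Q4 (A1 `&` A2) = tail H x ^+ 2.
  rewrite (_ : A1 `&` A2 = s1 @^-1` `]x, +oo[ `&` s2 @^-1` `]x, +oo[).
    by rewrite Q4_rect// -!tailE.
  apply/seteqP; split => z; first by move=> [[? _] [_ ?]].
  move=> [xz1 xz2]; split; split => //; rewrite /= in_itv/= andbT.
    by move: xz2; rewrite /= in_itv/= andbT => /ltW; exact: le_trans.
  by move: xz1; rewrite /= in_itv/= andbT => /ltW; exact: le_trans.
have e : pr Q4 (A1 `|` A2) = tail H x + tail H x - tail H x ^+ 2.
  exact: prUI_eq mA1 mA2 A1P A2P A12P.
apply: (add_le_sub_sqr CP e); rewrite tail_HH.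
apply: prU_disj_le; clear A1P A2P A12P CP EP e => //.
- exact: measurableU.
- have -> : [set z : (R * R) * (R * R) | x < z.1.1 + z.1.2 + (z.2.1 + z.2.2)] =
    (s1 \+ s2) @^-1` `]x, +oo[.
    by apply/seteqP; split => z; rewrite /= in_itv/= andbT.
  by apply: mpre; exact: measurable_funD.
- apply/seteqP; split => // -[[a b] [c f]] [[[_ [/= ae1 ae2]] [[_ +] [+ _]]]].
  rewrite /A1 /A2 /s1 /s2 /= !in_itv/= in ae1 ae2 *.
  move=> /andP[b0 bK] /andP[c0 cK].
  by case => -[]; rewrite /= !andbT; lra.
- move=> [[a b] [c f]] [[]|[]].
  + rewrite /cross /sum_above /= => -[xae _] [[_ /=]]; rewrite in_itv/= => /andP[b0 _].
    by move=> [/=]; rewrite in_itv/= => /andP[c0 _] _; lra.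
  + by rewrite /A1 /s1 /s2 => -[] /=; rewrite !in_itv/= !andbT; lra.
  + by rewrite /A2 /s1 /s2 => -[] /=; rewrite !in_itv/= !andbT; lra.
Qed.

(** From below, each summand may exceed [x] alone. From above, either a summand
    exceeds [x - K], where the shift is immaterial by [shift1] and [shift2], or the
    cross event occurs, which is negligible by [cross_le]. *)
Lemma tail_convolution_equiv :
  (tail F1 x + tail F2 x) / tail H x @[x --> +oo] --> (1 : R).
Proof.
have [H0 Hpos H2] := Hsub.
have [K [K0 K1 K2]] : exists K, [/\ 0 <= K, tail F1 K < 2^-1 & tail F2 K < 2^-1].
  have h2 : (0 : R) < 2^-1 by rewrite invr_gt0.
  near (pinfty_nbhs R) => K; exists K; split.
  - by near: K; apply: nbhs_pinfty_ge; rewrite num_real.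
  - by near: K; apply: (cvgr_lt _ (tail_cvg0 F1)).
  - by near: K; apply: (cvgr_lt _ (tail_cvg0 F2)).
pose up x := 1 + tail F2 x.
pose lo x := 1 - (4 * (tail H (x + - K) / tail H x - tail H (x + K) / tail H x) +
  4 * (tail (conv_pow H 2) x / tail H x - 2 + tail H x)).
apply: (@squeeze_cvgr _ _ _ _ lo up).
- near=> x.
  have x0 : 0 <= x by near: x; apply: nbhs_pinfty_ge; rewrite num_real.
  have Hx := Hpos x.
  apply/andP; split; last first.
    rewrite ler_pdivrMr// /up mulrDl mul1r.
    have := tail_ge x0; have := tail_le1f x0; have := tail_ge0 F2 x.
    by rewrite [tail F2 x * _]mulrC => f2 f1 ; nra.
  rewrite ler_pdivlMr// /lo tail_conv_pow2.
  rewrite lower_bound_mul//.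
  have := tail_le K x; have := shift1 x K0; have := shift2 x K0.
  have := cross_le K0 x0; have := @pr_ge0 _ _ _ Q (cross K x).
  have d1 : tail F1 x <= tail F1 (x - K) by apply: tail_nonincreasing; rewrite gerBl.
  have d2 : tail F2 x <= tail F2 (x - K) by apply: tail_nonincreasing; rewrite gerBl.
  move: (pr Q _) (tail (convolution H H) x) => c hh c0 hc.
  have c4 : c <= 4 * (hh - 2 * tail H x + tail H x ^+ 2).
    apply: le_trans (ler_wpM2l _ hc) => //.
    by rewrite mulrA ler_peMl// -[leLHS](_ : 4 * (2^-1 * 2^-1) = 1) ?ler_wpM2l//; [apply: ler_pM; rewrite ?invr_ge0//; lra|field].
  move=> /(half_bound _ (ltW K1)) f2 /(half_bound _ (ltW K2)) f1.
  rewrite !subr_ge0 in f1 f2.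
  exact: lower_bound_arith (f1 d1) (f2 d2) c4.
- rewrite /lo -[X in _ --> X](_ : 1 - (4 * (1 - 1) + 4 * (2 - 2 + 0)) = 1 :> R); last by ring.
  apply: cvgB; first exact: cvg_cst.
  apply: cvgD; apply: cvgM; try exact: cvg_cst.
    by apply: cvgB; exact: long_tail.
  apply: cvgD; last exact: tail_cvg0.
  by apply: cvgB; [exact: H2|exact: cvg_cst].
- rewrite /up -[X in _ --> X]addr0; apply: cvgD; first exact: cvg_cst.
  exact: tail_cvg0.
Unshelve. all: by end_near. Qed.

End convolution_factors.

(** * Mixing over a discrete random variable *)

Section discrete_measurability.
Context {d : measure_display} {T : measurableType d} {R : realType}.
Context {I : countType}.
Variable V : T -> I.
Hypothesis mV : forall v, measurable (V @^-1` [set v]).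

Lemma measurable_discrete_preimage (B : set I) : measurable (V @^-1` B).
Proof.
have -> : V @^-1` B = \bigcup_(v in B) (V @^-1` [set v]).
  by apply/seteqP; split => [w Bw|w [v Bv /= ->//]]; exists (V w).
rewrite bigcup_mkcond; apply: countable_bigcupT_measurable => [|v].
  exact: countableP.
by case: ifP.
Qed.

Lemma measurable_discrete d' (U : measurableType d') (f : I -> U) :
  measurable_fun setT (fun w => f (V w)).
Proof.
by move=> _ B mB; rewrite setTI; exact: (measurable_discrete_preimage (f @^-1` B)).
Qed.

Lemma measurable_discrete_event (A : I -> set T) : (forall v, measurable (A v)) ->
  measurable [set w | A (V w) w].
Proof.
move=> mA; have -> : [set w | A (V w) w] =
    \bigcup_v (A v `&` V @^-1` [set v]).
  apply/seteqP; split => [w Aw|w [v _ [/= Aw Vv]]]; first by exists (V w).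
  by rewrite Vv.
apply: countable_bigcupT_measurable => [|v]; first exact: countableP.
exact: measurableI.
Qed.

End discrete_measurability.

Section discrete_mixture.
Context {d : measure_display} {T : measurableType d} {R : realType}.
Variable P : probability T R.

Lemma trivIset_fibers (I : Type) (V : T -> I) :
  trivIset setT (fun k => V @^-1` [set k]).
Proof.
move=> i j _ _ [w [/= ? ?]]; congruence.
Qed.

Lemma bigcup_fibers (V : T -> nat) : \bigcup_k (V @^-1` [set k]) = setT.
Proof. by apply/seteqP; split => // w _; exists (V w). Qed.

Lemma integral_nat (V : T -> nat) (f : nat -> \bar R) :
  (forall k, measurable (V @^-1` [set k])) -> (forall v, 0 <= f v)%E ->
  (\int[P]_w f (V w) = \sum_(k <oo) f k * P (V @^-1` [set k]))%E.
Proof.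
move=> mV f0; rewrite -(bigcup_fibers V) ge0_integral_bigcup//; last 2 first.
- by rewrite bigcup_fibers; exact: measurable_discrete.
- exact: trivIset_fibers.
apply: eq_eseriesr => k _.
under eq_integral => w /[!inE] /= -> do over.
by rewrite integral_cst.
Qed.

Lemma mixture_nat (V : T -> nat) (A : nat -> set T) (a : nat -> \bar R) :
  (forall v, measurable (V @^-1` [set v])) -> (forall v, measurable (A v)) ->
  (forall v, 0 <= a v)%E ->
  (forall v, P (A v `&` V @^-1` [set v]) = a v * P (V @^-1` [set v]))%E ->
  P [set w | A (V w) w] = (\int[P]_w a (V w))%E.
Proof.
move=> mV mA a0 Aa; rewrite integral_nat//.
have -> : [set w | A (V w) w] = \bigcup_v (A v `&` V @^-1` [set v]).
  apply/seteqP; split => [w Aw|w [v _ [/= Aw Vv]]]; first by exists (V w).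
  by rewrite Vv.
rewrite measure_bigcup//; last 2 first.
- by move=> v _; exact: measurableI.
- by apply: trivIset_setIl; exact: trivIset_fibers.
rewrite [LHS]eseries_mkcond; apply: eq_eseriesr => v _.
rewrite in_setT.
exact: Aa.
Qed.

(** The law of total probability over the countably many values of [V], which are
    coded by integers so that a series sums over them. *)
Lemma mixture (I : countType) (V : T -> I) (A : I -> set T) (a : I -> \bar R) :
  (forall v, measurable (V @^-1` [set v])) -> (forall v, measurable (A v)) ->
  (forall v, 0 <= a v)%E ->
  (forall v, P (A v `&` V @^-1` [set v]) = a v * P (V @^-1` [set v]))%E ->
  P [set w | A (V w) w] = (\int[P]_w a (V w))%E.
Proof.
move=> mV mA a0 Aa.
pose A' k := if @pickle_inv I k is Some v then A v else set0.
pose a' k := if @pickle_inv I k is Some v then a v else 0%E.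
pose V' w := choice.pickle (V w).
have a'E w : a (V w) = a' (V' w) by rewrite /a' /V' pickleK_inv.
under eq_integral do rewrite a'E.
rewrite -(@mixture_nat V' A'); first last.
- move=> k; rewrite /A' /a'; case E: (@pickle_inv I k) => [v|]; last first.
    by rewrite set0I measure0 mul0e.
  have kv : choice.pickle v = k by have := @pickle_invK I k; rewrite E.
  suff -> : V' @^-1` [set k] = V @^-1` [set v] by [].
  apply/seteqP; split => w /=; rewrite /V' -kv; last by move=> ->.
  exact: (pcan_inj choice.pickleK).
- by move=> k; rewrite /a'; case: (@pickle_inv I k).
- by move=> k; rewrite /A'; case: (@pickle_inv I k).
- by move=> k; exact: (measurable_discrete_preimage mV (choice.pickle @^-1` [set k])).
congr (P _); apply/seteqP; split => w /=; rewrite /A' /V' pickleK_inv//.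
Qed.

Lemma dominated_limit (f : nat -> T -> R) (g h : T -> R) :
  (forall n, measurable_fun setT (f n)) -> measurable_fun setT h ->
  measurable_fun setT g -> (\int[P]_w (g w)%:E < +oo)%E ->
  (forall n w, 0 <= f n w <= g w) -> (forall w, f n w @[n --> \oo] --> h w) ->
  fine (\int[P]_w (f n w)%:E) @[n --> \oo] --> fine (\int[P]_w (h w)%:E)%E.
Proof.
move=> mf mh mg ig fg fh.
have g0 w : 0 <= g w by have /andP[f0 /(le_trans f0)] := fg 0%N w.
have Ig : P.-integrable setT (EFin \o g).
  apply/integrableP; split; first exact/measurable_EFinP.
  by under eq_integral do rewrite /= ger0_norm//.
have [] // := @dominated_convergence _ _ _ P setT measurableT
  (fun n => EFin \o f n) (EFin \o h) (EFin \o g).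
- by move=> n; exact/measurable_EFinP.
- exact/measurable_EFinP.
- by apply: aeW => w _; apply/cvg_EFin; [exact: nearW|exact: fh].
- apply: aeW => w n _ /=; rewrite lee_fin.
  by have /andP[f0 f1] := fg n w; rewrite ger0_norm.
move=> Ih _ cvgI; apply: fine_cvg; rewrite fineK//.
by apply: integrable_fin_num.
Qed.

End discrete_mixture.

(** The filter has a countable base, so sequences detect its limits; this makes
    dominated convergence available. *)
Lemma cvg_both_pinftyP (R : realType) (f : R * R -> R) (l : R) :
  (forall u1 u2 : nat -> R, u1 n @[n --> \oo] --> +oo ->
    u2 n @[n --> \oo] --> +oo -> f (u1 n, u2 n) @[n --> \oo] --> l) ->
  f u @[u --> both_pinfty R] --> l.
Proof.
move=> fl; apply/cvgrPdist_lt => e e0.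
have [//|noe] := pselect (\forall t \near both_pinfty R, `|l - f t| < e).
have bad (n : nat) : exists u : R * R, [/\ n%:R < u.1, n%:R < u.2 & e <= `|l - f u|].
  apply/not_existsP => nou; apply: noe.
  exists ([set x | n%:R < x], [set x | n%:R < x]).
    by split; exists n%:R; split => //; exact: num_real.
  move=> u [/= u1 u2]; have := nou u => h.
  by rewrite ltNge; apply/negP => ue; apply: h.
pose u n := sval (cid (bad n)).
have u1 n : n%:R < (u n).1 by rewrite /u; case: cid => x [].
have u2 n : n%:R < (u n).2 by rewrite /u; case: cid => x [].
have ue n : e <= `|l - f (u n)| by rewrite /u; case: cid => x [].
have toinf (v : nat -> R) : (forall n, n%:R < v n) -> v n @[n --> \oo] --> +oo.
  move=> nv; apply/cvgryPgt => A; near=> n.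
  by apply: lt_trans (nv n); near: n; exact: nbhs_infty_gtr.
have /cvgrPdist_lt/(_ e e0) [N _ /(_ N (leqnn N))] := fl _ _ (toinf _ u1) (toinf _ u2).
by rewrite /= -surjective_pairing ltNge ue.
Unshelve. all: by end_near. Qed.

(** * Random sums of subexponential claims with a random shift of the level *)

(** Separates the exponential moments of variables that may depend on each other. *)
Lemma mul_le_sqrD (R : realDomainType) (p q : R) : 0 <= p -> 0 <= q ->
  p * q <= p ^+ 2 + q ^+ 2.
Proof. by move=> p0 q0; nra. Qed.

Section random_sums.
Context {d : measure_display} {T : measurableType d} {R : realType}.
Variable P : probability T R.
Context {I : countType}.
Variable V : T -> I.
Hypothesis mV : forall v, measurable (V @^-1` [set v]).

Definition finite_mean (f : I -> R) := (\int[P]_w (f (V w))%:E < +oo)%E.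

Let mf (f : I -> R) : measurable_fun setT (fun w => (f (V w))%:E).
Proof. by apply/measurable_EFinP; exact: measurable_discrete. Qed.

Lemma finite_meanD (f g : I -> R) : (forall v, 0 <= f v) -> (forall v, 0 <= g v) ->
  finite_mean f -> finite_mean g -> finite_mean (fun v => f v + g v).
Proof.
move=> f0 g0 ff fg; rewrite /finite_mean; under eq_integral do rewrite EFinD.
rewrite ge0_integralD//; first exact: lte_add_pinfty.
- by move=> w _; rewrite lee_fin.
- by move=> w _; rewrite lee_fin.
Qed.

Lemma finite_meanZ (c : R) (f : I -> R) : 0 <= c -> (forall v, 0 <= f v) ->
  finite_mean f -> finite_mean (fun v => c * f v).
Proof.
move=> c0 f0 ff; rewrite /finite_mean; under eq_integral do rewrite EFinM.
rewrite ge0_integralZl//; first exact: lte_mul_pinfty.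
by move=> w _; rewrite lee_fin.
Qed.

Variable n : I -> nat.
Hypothesis n_exp : forall r, 0 <= r -> finite_mean (fun v => r ^+ n v).

(** The conditional probability, given the index [v], that [n v] claims exceed the
    shifted level, relative to the probability that one claim exceeds [u]. *)
Definition shifted_ratio (F : probability R R) (s : I -> R) (u : R) (v : I) : R :=
  tail (conv_pow F (n v)) (u + s v) / tail F u.

Section one_ratio.
Variables (F : probability R R) (s : I -> R) (b : I -> nat).
Hypothesis Fsub : subexponential F.
Hypothesis sb : forall v, - (b v)%:R <= s v.

Lemma shifted_ratio_ge0 u v : 0 <= shifted_ratio F s u v.
Proof. by rewrite divr_ge0// tail_ge0. Qed.

(** A bound uniform in the level [u], as dominated convergence requires. *)
Lemma shifted_ratio_bound : exists C r : R, [/\ 0 <= C, 1 <= r &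
  forall u v, shifted_ratio F s u v <= C * r ^+ n v * 2 ^+ b v].
Proof.
have [_ Fpos _] := Fsub.
have [r r1 rb] := kesten_bound Fsub.
have lt12 : 1 < 2 :> R by rewrite ltr1n.
have [c c0 cb] := long_tail_geom Fsub lt12.
exists c, r; split => // u v; rewrite /shifted_ratio ler_pdivrMr//.
apply: (le_trans (rb _ _)).
rewrite [c * _]mulrC -!mulrA ler_wpM2l//; first by rewrite exprn_ge0// (le_trans _ r1).
rewrite mulrA; apply: le_trans (cb _ _); apply: tail_nonincreasing.
by rewrite lerD2l.
Qed.

Lemma shifted_ratio_cvg (u : nat -> R) v : u k @[k --> \oo] --> +oo ->
  shifted_ratio F s (u k) v @[k --> \oo] --> ((n v)%:R : R).
Proof.
by move=> uy; apply: (cvg_comp u (fun x => shifted_ratio F s x v) uy);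
  exact: conv_pow_shift.
Qed.

End one_ratio.

Variables (F1 F2 : probability R R) (s1 s2 : I -> R) (b1 b2 : I -> nat).
Hypotheses (F1sub : subexponential F1) (F2sub : subexponential F2).
Hypotheses (sb1 : forall v, - (b1 v)%:R <= s1 v) (sb2 : forall v, - (b2 v)%:R <= s2 v).
Hypothesis b1_exp : forall r, 0 <= r -> finite_mean (fun v => r ^+ b1 v).
Hypothesis b2_exp : forall r, 0 <= r -> finite_mean (fun v => r ^+ b2 v).

Lemma random_sum_cvg :
  fine (\int[P]_w (shifted_ratio F1 s1 u (V w))%:E) @[u --> +oo] -->
  fine (\int[P]_w ((n (V w))%:R)%:E)%E.
Proof.
apply/cvg_pinftyP => u uy.
have [C [r [C0 r1 bound]]] := shifted_ratio_bound F1sub sb1.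
have r0 : 0 <= r by rewrite (le_trans _ r1).
pose g v := C * ((r ^+ 2) ^+ n v + 4 ^+ b1 v).
apply: (@dominated_limit _ _ _ P (fun k w => shifted_ratio F1 s1 (u k) (V w))
  (fun w => g (V w)) (fun w => (n (V w))%:R)).
- by move=> k; exact: (measurable_discrete mV (shifted_ratio F1 s1 (u k))).
- exact: (measurable_discrete mV (fun v => (n v)%:R : R)).
- exact: measurable_discrete.
- rewrite -/(finite_mean g); apply: finite_meanZ => // [v|].
    by rewrite addr_ge0// !exprn_ge0.
  apply: finite_meanD => [v|v||]; rewrite ?exprn_ge0//.
    by apply: n_exp; exact: exprn_ge0.
  by apply: b1_exp; rewrite ler0n.
- move=> k w; rewrite shifted_ratio_ge0/=; apply: (le_trans (bound _ _)).
  rewrite /g -mulrA ler_wpM2l// (_ : 4 = 2 ^+ 2 :> R); last by rewrite -natrX.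
  rewrite [(r ^+ 2) ^+ _]exprAC [(2 ^+ 2) ^+ _]exprAC.
  by apply: mul_le_sqrD; rewrite exprn_ge0.
- by move=> w; exact: shifted_ratio_cvg.
Qed.

Lemma random_sum2_cvg :
  fine (\int[P]_w (shifted_ratio F1 s1 u.1 (V w) * shifted_ratio F2 s2 u.2 (V w))%:E)
    @[u --> both_pinfty R] -->
  fine (\int[P]_w ((n (V w))%:R ^+ 2)%:E)%E.
Proof.
apply: cvg_both_pinftyP => u1 u2 u1y u2y /=.
have [C1 [r1 [C10 r11 bound1]]] := shifted_ratio_bound F1sub sb1.
have [C2 [r2 [C20 r21 bound2]]] := shifted_ratio_bound F2sub sb2.
have r10 : 0 <= r1 by rewrite (le_trans _ r11).
have r20 : 0 <= r2 by rewrite (le_trans _ r21).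
pose r := r1 * r2; have r0 : 0 <= r by rewrite mulr_ge0.
(* With [p] the power of [r] and [q], [t] the powers of [2], the dominating function
   comes from [p * (q * t) <= p ^+ 2 + (q ^+ 4 + t ^+ 4)]. *)
pose g v := (C1 * C2) * ((r ^+ 2) ^+ n v + (16 ^+ b1 v + 16 ^+ b2 v)).
apply: (@dominated_limit _ _ _ P (fun k w => shifted_ratio F1 s1 (u1 k) (V w) *
   shifted_ratio F2 s2 (u2 k) (V w))
  (fun w => g (V w)) (fun w => (n (V w))%:R ^+ 2)).
- move=> k; apply: measurable_funM.
    exact: (measurable_discrete mV (shifted_ratio F1 s1 (u1 k))).
  exact: (measurable_discrete mV (shifted_ratio F2 s2 (u2 k))).
- exact: (measurable_discrete mV (fun v => (n v)%:R ^+ 2 : R)).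
- exact: measurable_discrete.
- rewrite -/(finite_mean g).
  have h16 (b : nat) : 0 <= (16 : R) ^+ b by rewrite exprn_ge0// ler0n.
  apply: finite_meanZ => [|v|]; first exact: mulr_ge0.
    by rewrite addr_ge0// ?addr_ge0// !exprn_ge0.
  apply: finite_meanD => [v|v||]; rewrite ?addr_ge0 ?exprn_ge0//.
    by apply: n_exp; exact: exprn_ge0.
  by apply: finite_meanD => //; [apply: b1_exp|apply: b2_exp]; rewrite ler0n.
- move=> k w; rewrite mulr_ge0 ?shifted_ratio_ge0//=.
  apply: (le_trans (ler_pM (shifted_ratio_ge0 _ _ _ _) (shifted_ratio_ge0 _ _ _ _)
    (bound1 _ _) (bound2 _ _))).
  rewrite /g; move: (n (V w)) (b1 (V w)) (b2 (V w)) => a x y.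
  have -> : C1 * r1 ^+ a * 2 ^+ x * (C2 * r2 ^+ a * 2 ^+ y) =
    (C1 * C2) * (r ^+ a * (2 ^+ x * 2 ^+ y)) by rewrite exprMn; ring.
  rewrite ler_wpM2l//; first exact: mulr_ge0.
  rewrite exprAC (_ : 16 = 4 ^+ 2 :> R); last by rewrite -natrX.
  rewrite ![(4 ^+ 2) ^+ _]exprAC (_ : 4 = 2 ^+ 2 :> R); last by rewrite -natrX.
  rewrite ![(2 ^+ 2) ^+ _]exprAC.
  move: (r ^+ a) (2 ^+ x) (2 ^+ y) (exprn_ge0 a r0) (exprn_ge0 x (ler0n R 2))
    (exprn_ge0 y (ler0n R 2)) => p q t p0 q0 t0.
  apply: (@le_trans _ _ (p ^+ 2 + (q * t) ^+ 2)).
    by apply: mul_le_sqrD => //; exact: mulr_ge0.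
  by rewrite lerD2l exprMn; apply: mul_le_sqrD; exact: sqr_ge0.
- by move=> w; apply: cvgM; exact: shifted_ratio_cvg.
Qed.

End random_sums.

(** * Moments of the claim number *)

Section poisson_moments.
Context {d : measure_display} {T : measurableType d} {R : realType}.
Variable P : probability T R.
Variables (mu : R) (N : T -> nat).
Hypothesis mu0 : 0 < mu.
Hypothesis mN : forall k, measurable (N @^-1` [set k]).
Hypothesis PN : forall k, P (N @^-1` [set k]) = (poisson_pmf mu k)%:E.

Lemma poisson_pmf_sum (m : R) : 0 < m ->
  (\sum_(k <oo) (poisson_pmf m k)%:E = 1)%E.
Proof.
move=> m0; have := probability_setT (poisson_prob m 0 : probability nat R).
rewrite /= /poisson_prob m0 -nneseries_esumT//.
by move=> k; rewrite lee_fin poisson_pmf_ge0.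
Qed.

Lemma poisson_pmfS k : k.+1%:R * poisson_pmf mu k.+1 = mu * poisson_pmf mu k.
Proof.
rewrite /poisson_pmf mu0 factS natrM invfM exprS.
have a0 : (k.+1%:R : R) != 0 by rewrite pnatr_eq0.
have f0 : (k`!%:R : R) != 0 by rewrite pnatr_eq0 -lt0n fact_gt0.
by move: (k.+1%:R : R) (k`!%:R : R) (expR _) a0 f0 => a f e a0 f0; field; rewrite a0 f0.
Qed.

(** [k * p_k = mu * p_(k-1)] shifts the index of summation by one. With [g] constant
    and [g] the identity this gives the first two moments. *)
Lemma poisson_mean_shift (g : nat -> R) : (forall k, 0 <= g k) ->
  (\int[P]_w ((N w)%:R * g (N w))%:E =
   mu%:E * \int[P]_w (g (N w).+1)%:E)%E.
Proof.
move=> g0; have g0' k : (0 <= ((k%:R : R) * g k)%:E)%E by rewrite lee_fin mulr_ge0.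
rewrite (integral_nat P mN (f := fun k => (k%:R * g k)%:E))//.
rewrite (integral_nat P mN (f := fun k => (g k.+1)%:E))//; last first.
  by move=> k; rewrite lee_fin.
rewrite nneseries_recl//; last first.
  by move=> k _; rewrite PN -EFinM lee_fin !mulr_ge0 ?poisson_pmf_ge0.
rewrite mul0r mul0e add0e -nneseries_addn; last first.
  by move=> k; rewrite PN -EFinM lee_fin !mulr_ge0 ?poisson_pmf_ge0.
rewrite -nneseriesZl//; last first.
  by move=> k _; rewrite PN -EFinM lee_fin mulr_ge0// poisson_pmf_ge0.
apply: eq_eseriesr => k _; rewrite !PN -!EFinM addn1; congr (_%:E).
by rewrite mulrAC poisson_pmfS; ring.
Qed.

Lemma poisson_mean : (\int[P]_w ((N w)%:R)%:E = mu%:E)%E.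
Proof.
have := @poisson_mean_shift (fun=> 1) (fun=> ler01).
under eq_integral do rewrite mulr1.
move=> ->; rewrite integral_cst// mul1e -[RHS]mule1.
congr (_ * _)%E; exact: probability_setT.
Qed.

Lemma poisson_mean_sqr : (\int[P]_w ((N w)%:R ^+ 2)%:E = (mu * (1 + mu))%:E)%E.
Proof.
have := @poisson_mean_shift (fun k => k%:R) (fun k => ler0n _ k).
under eq_integral do rewrite -expr2.
move=> ->; rewrite EFinM; congr (_ * _)%E.
under eq_integral do rewrite -natr1 addrC EFinD.
rewrite ge0_integralD//; last first.
  by apply/measurable_EFinP; exact: (measurable_discrete mN (fun k => k%:R : R)).
rewrite poisson_mean integral_cst// mul1e [RHS]EFinD; congr (_ + _)%E.
exact: probability_setT.
Qed.

Lemma poisson_exp_moment (r : R) : 0 <= r -> (\int[P]_w (r ^+ N w)%:E < +oo)%E.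
Proof.
(* The series of [q ^+ k * poisson_pmf mu k] is, up to a factor, the one of the
   Poisson law of parameter [q * mu], which has to be positive: [r] is enlarged. *)
move=> r0; pose q := r + 1; have q0 : 0 < q by rewrite ltr_wpDl.
apply: (@le_lt_trans _ _ (\int[P]_w (q ^+ N w)%:E)%E).
  apply: ge0_le_integral => //.
  - by move=> w _; rewrite lee_fin exprn_ge0.
  - by apply/measurable_EFinP; exact: (measurable_discrete mN (fun k => r ^+ k : R)).
  - by apply/measurable_EFinP; exact: (measurable_discrete mN (fun k => q ^+ k : R)).
  - by move=> w _; rewrite lee_fin lerXn2r// ?nnegrE ?ltW// /q ltrDl.
rewrite (integral_nat P mN (f := fun k => (q ^+ k)%:E)); last first.
  by move=> k; rewrite lee_fin exprn_ge0// ltW.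
rewrite (_ : (\sum_(k <oo) _)%E = (expR ((q - 1) * mu))%:E)%E ?ltry//.
rewrite -[RHS]mule1 -(poisson_pmf_sum (mulr_gt0 q0 mu0)) -nneseriesZl; last first.
  by move=> k _; rewrite lee_fin poisson_pmf_ge0.
apply: eq_eseriesr => k _; rewrite PN -!EFinM; congr (_%:E).
rewrite /poisson_pmf mu0 mulr_gt0// exprMn.
rewrite mulrBl mul1r expRD expRN -expRN; rewrite [expR (- (q * mu))]expRN.
have := lt0r_neq0 (expR_gt0 (q * mu)); move: (expR (q * mu)) => e e0.
have f0 : (k`!%:R : R) != 0 by rewrite pnatr_eq0 -lt0n fact_gt0.
by move: (k`!%:R : R) (expR _) f0 => f h f0; field; rewrite e0 f0.
Qed.

End poisson_moments.

(** * Exponential moments of the running maximum of a Brownian motion *)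

Section gaussian_tail.
Context {R : realType}.

(** On the half-line above [z] the centred density is at most [exp (- z^2 / (2 s^2))]
    times the density with mean [z]: moving the mean to the boundary point bounds the
    tail without computing an integral. Likewise below [- z]. *)
Lemma normal_prob_tail (s z : R) : 0 < s -> 0 <= z ->
  (normal_prob 0 s [set x | (z < `|x|)%R] <= (2 * expR (- (z ^+ 2 / (2 * s ^+ 2))))%:E)%E.
Proof.
move=> s0 z0; have sn0 : s != 0 by rewrite gt_eqF.
set e := expR _.
have half (c : R) (D : set R) : measurable D -> `|c| = z ->
    (forall x, D x -> z ^+ 2 <= c * x) ->
    (normal_prob 0 s D <= e%:E)%E.
  move=> mD cz Dc; apply: (@le_trans _ _ (e%:E * normal_prob c s D)%E); last first.
    rewrite -[leRHS]mule1; apply: lee_wpmul2l; first by rewrite lee_fin expR_ge0.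
    exact: probability_le1.
  rewrite /normal_prob -ge0_integralZl//; last 3 first.
  - by apply/measurable_EFinP; apply: measurable_funTS; exact: measurable_normal_pdf.
  - by move=> x _; rewrite lee_fin normal_pdf_ge0.
  - by rewrite lee_fin expR_ge0.
  apply: ge0_le_integral => //.
  - by move=> x _; rewrite lee_fin normal_pdf_ge0.
  - by apply/measurable_EFinP; apply: measurable_funTS; exact: measurable_normal_pdf.
  - apply/measurable_EFinP; apply: measurable_funM => //.
    by apply: measurable_funTS; exact: measurable_normal_pdf.
  move=> x Dx; rewrite -EFinM lee_fin !normal_pdfE// mulrCA ler_wpM2l ?normal_peak_ge0//.
  rewrite /normal_fun /e -expRD ler_expR subr0.
  have s2 : 0 < s ^+ 2 by rewrite exprn_gt0.
  rewrite -(mulr_natl (s ^+ 2)) !mulNr -opprD lerN2 -mulrDl.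
  rewrite ler_wpM2r//; first by rewrite invr_ge0; apply: mulr_ge0 => //; exact: ltW.
  have -> : z ^+ 2 = c ^+ 2 by rewrite -cz real_normK ?num_real.
  have := Dc x Dx; rewrite -cz real_normK ?num_real//; nra.
have -> : [set x | z < `|x|] = `]z, +oo[%classic `|` `]-oo, (- z)[%classic.
  apply/seteqP; split => x /=; rewrite !in_itv/= andbT lter_normr.
    by move=> /orP[->|]; [left|right; rewrite ltrNr].
  by move=> [->//|]; rewrite ltrNr => ->; rewrite orbT.
apply: (@le_trans _ _ (normal_prob 0 s `]z, +oo[%classic + normal_prob 0 s `]-oo, (- z)%R[%classic)%E).
  exact: measureU2.
rewrite mulr_natl mulr2n EFinD; apply: leeD.
  apply: (half z) => //; first by rewrite ger0_norm.
  by move=> x /=; rewrite in_itv/= andbT => /ltW zx; rewrite expr2 ler_wpM2l.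
apply: (half (- z)) => //; first by rewrite normrN ger0_norm.
move=> x /=; rewrite in_itv/= => /ltW zx; rewrite expr2 mulNr -mulrN ler_wpM2l//.
by rewrite lerNr.
Qed.

End gaussian_tail.

Lemma expR2_ge4 (R : realType) : (4 : R) <= expR 2.
Proof.
rewrite (_ : 2 = 1 + 1 :> R)// expRD (_ : 4 = 2 * 2 :> R); last by rewrite -natrM.
by apply: ler_pM => //; exact: expR_ge1Dx.
Qed.

Section brownian_maximum.
Context {d : measure_display} {Omega : measurableType d} {R : realType}.
Variable P : probability Omega R.
Variable B : R -> {RV P >-> R}.
Hypothesis BM : brownian_motion B.
Variable T : R.
Hypothesis T0 : 0 < T.

Let B0 w : B 0 w = 0. Proof. by case: BM. Qed.

Definition grid (n k : nat) : R := T * (k%:R / 2 ^+ n).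

Lemma grid_double n k : grid n.+1 k.*2 = grid n k.
Proof.
by rewrite /grid exprS -mul2n natrM invfM mulrACA divff// mul1r.
Qed.

Definition increment n k w := B (grid n k.+1) w - B (grid n k) w.

(** An increment over the mesh [T / 2 ^+ n] has variance of order [2 ^- n]. The
    threshold decreases slowly enough for its square to outgrow this variance by the
    factor [9 / 8] at each level, yet has a finite sum. *)
Definition bad (y : R) n k : set Omega := [set w | y * (3 / 4) ^+ n < `|increment n k w|].

Lemma measurable_bad y n k : measurable (bad y n k).
Proof.
have mi : measurable_fun setT (fun w => `|increment n k w|).
  by apply: measurableT_comp => //; exact: measurable_funB.
rewrite (_ : bad _ _ _ = (fun w => `|increment n k w|) @^-1` `]y * (3 / 4) ^+ n, +oo[%classic).
  by rewrite -[X in measurable X]setTI; exact: mi.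
by apply/seteqP; split => w; rewrite /bad /= in_itv/= andbT.
Qed.

(** The condition on [y] makes [y ^+ 2 / (2 * T)] at least [16], so that Bernoulli's
    inequality for [(9 / 8) ^+ n] leaves a factor [expR (- 2) ^+ n] to spare; this beats
    the number [2 ^ n] of increments of level [n]. *)
Lemma pr_bad y n k : 0 <= y -> 32 * T <= y ^+ 2 -> (k < 2 ^ n)%N ->
  (P (bad y n k) <= (2 * (expR (- (y ^+ 2 / (2 * T))) / 4 ^+ n))%:E)%E.
Proof.
move=> y0 yT kn; have [_ _ _ BN] := BM.
have pn0 : 0 < 2 ^+ n :> R by rewrite exprn_gt0.
pose z := y * (3 / 4) ^+ n.
have z0 : 0 <= z by rewrite mulr_ge0// exprn_ge0// divr_ge0.
have st : grid n k < grid n k.+1.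
  by rewrite /grid ltr_pM2l// ltr_pM2r ?invr_gt0// ltr_nat.
have g0 : 0 <= grid n k by rewrite mulr_ge0 ?(ltW T0)// divr_ge0// ltW.
have mA : measurable [set x : R | z < `|x|].
  rewrite (_ : [set x | _] = (@Num.norm _ R) @^-1` `]z, +oo[%classic).
    by rewrite -[X in measurable X]setTI; exact: normr_measurable.
  by apply/seteqP; split => w; rewrite /= in_itv/= andbT.
rewrite (_ : bad y n k = [set w | [set x : R | z < `|x|] (B (grid n k.+1) w - B (grid n k) w)])//.
rewrite (BN _ _ _ g0 st mA).
have dE : grid n k.+1 - grid n k = T / 2 ^+ n.
  by rewrite /grid -natr1 mulrDl mulrDr addrAC subrr add0r mul1r.
have d0 : 0 < grid n k.+1 - grid n k by rewrite subr_gt0.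
apply: (le_trans (normal_prob_tail _ z0)); first by rewrite sqrtr_gt0.
rewrite sqr_sqrtr ?(ltW d0)// lee_fin ler_wpM2l// dE /z.
have c16 : 16 <= y ^+ 2 / (2 * T).
  by rewrite ler_pdivlMr ?mulr_gt0// mulrA -natrM.
rewrite (_ : (y * (3 / 4) ^+ n) ^+ 2 / (2 * (T / 2 ^+ n)) =
    y ^+ 2 / (2 * T) * (9 / 8) ^+ n); last first.
  rewrite (_ : 9 / 8 = (3 / 4) * (3 / 4) * 2 :> R); last by field.
  rewrite !exprMn; have := lt0r_neq0 T0; have := lt0r_neq0 pn0.
  by move: (2 ^+ n) (3 ^+ n) (4^-1 ^+ n) => a b c a0 t0; field; rewrite a0 t0.
move: c16; move: (y ^+ 2 / (2 * T)) => c c16.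
have bern m : 1 + m%:R / 8 <= (9 / 8) ^+ m :> R.
  elim: m => [|m IH]; first by rewrite mul0r addr0 expr0.
  rewrite exprS -natr1; apply: (@le_trans _ _ (9 / 8 * (1 + m%:R / 8))).
    by have := ler0n R m; lra.
  by rewrite ler_wpM2l.
apply: (@le_trans _ _ (expR (- (c + n%:R * 2)))).
  rewrite ler_expR lerN2; apply: (@le_trans _ _ (c * (1 + n%:R / 8))).
    by have := ler0n R n; nra.
  by rewrite ler_wpM2l// (le_trans _ c16).
rewrite opprD expRD ler_wpM2l ?expR_ge0// expRN expRM_natl.
rewrite lef_pV2 ?posrE ?exprn_gt0 ?expR_gt0// lerXn2r ?nnegrE ?expR_ge0//.
exact: expR2_ge4.
Qed.

Lemma pr_bad_union y : 0 <= y -> 32 * T <= y ^+ 2 ->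
  (P (\bigcup_n \big[setU/set0]_(k < 2 ^ n) bad y n k) <=
    (4 * expR (- (y ^+ 2 / (2 * T))))%:E)%E.
Proof.
move=> y0 yT; set e := expR _.
have mb n : measurable (\big[setU/set0]_(k < 2 ^ n) bad y n k).
  by apply: bigsetU_measurable => k _; exact: measurable_bad.
apply: (@le_trans _ _ (\sum_(n <oo) (4 * e / (2 ^ n.+1)%:R)%:E)%E); last first.
  by apply: epsilon_trick0; rewrite mulr_ge0 ?expR_ge0.
apply: (@le_trans _ _ (\sum_(n <oo) P (\big[setU/set0]_(k < 2 ^ n) bad y n k))%E).
  apply: measure_sigma_subadditive => //; exact: bigcupT_measurable.
apply: lee_nneseries => [n _ //|n _].
apply: (@le_trans _ _ (\sum_(k < 2 ^ n) (2 * (e / 4 ^+ n))%:E)%E).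
  apply: le_trans (Boole_inequality _ _) _.
    by move=> k _; exact: measurable_bad.
  by apply: lee_sum => k _; exact: pr_bad.
rewrite sumEFin lee_fin sumr_const card_ord -[leLHS]mulr_natl.
rewrite !natrX exprS (_ : 4 ^+ n = 2 ^+ n * 2 ^+ n :> R); last first.
  by rewrite -exprMn -natrM.
have p0 : (2 ^+ n : R) != 0 by rewrite expf_neq0.
rewrite le_eqVlt; apply/orP; left; apply/eqP.
by move: (2 ^+ n) p0 => p p0; field.
Qed.

(** A point of level [n + 1] is at most one increment away from a point of level [n],
    and the thresholds add up to [4 * y]. The induction keeps the partial sum
    [4 * y - 3 * (y * (3 / 4) ^+ n)]. *)
Lemma chaining y w : 0 <= y -> (forall n k, (k < 2 ^ n)%N -> ~ bad y n k w) ->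
  forall n k, (k <= 2 ^ n)%N -> `|B (grid n k) w| <= 4 * y.
Proof.
move=> y0 good.
have inc n k : (k < 2 ^ n)%N -> `|increment n k w| <= y * (3 / 4) ^+ n.
  by move=> kn; rewrite leNgt; apply/negP; exact: good.
suff H n : forall k, (k <= 2 ^ n)%N ->
    `|B (grid n k) w| <= 4 * y - 3 * (y * (3 / 4) ^+ n).
  move=> n k kn; apply: (le_trans (H n k kn)).
  by rewrite gerBl !mulr_ge0// exprn_ge0// divr_ge0.
elim: n => [|n IH] k kn.
  have -> : B (grid 0 k) w = (if k == 1 then 1 else 0) * increment 0 0 w.
    rewrite /increment /grid expr0 mul0r mulr0 B0 subr0.
    case: k kn => [|[|//]] _; last by rewrite /= [RHS]mul1r.
    by rewrite mul0r mulr0 B0 mul0r.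
  have := inc 0 0 isT; rewrite expr0 !mulr1 normrM => h.
  case: eqP => _; rewrite ?normr1 ?normr0 ?mul1r ?mul0r; lra.
have yn : 0 <= y * (3 / 4) ^+ n by rewrite mulr_ge0// exprn_ge0// divr_ge0.
have e : y * (3 / 4) ^+ n.+1 = 3 / 4 * (y * (3 / 4) ^+ n) by rewrite exprS mulrCA.
rewrite e.
have even j : (j.*2 <= 2 ^ n.+1)%N -> `|B (grid n.+1 j.*2) w| <= 4 * y - 3 * (y * (3 / 4) ^+ n).
  by rewrite expnS mul2n leq_double => jn; rewrite grid_double; exact: IH.
have [kodd|keven] := boolP (odd k); last first.
  have kE : k = k./2.*2 by rewrite -[LHS]odd_double_half (negbTE keven).
  rewrite kE; apply: le_trans (even _ _) _; first by rewrite -kE.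
  by move: yn; move: (y * _) => a a0; lra.
have kE : k = k./2.*2.+1 by rewrite -[LHS]odd_double_half kodd.
have k1 : (k./2.*2 < 2 ^ n.+1)%N by rewrite -kE.
have -> : B (grid n.+1 k) w = B (grid n.+1 k./2.*2) w + increment n.+1 k./2.*2 w.
  by rewrite /increment -kE addrC subrK.
apply: (le_trans (ler_normD _ _)).
have := even _ (ltnW k1); have := inc _ _ k1; rewrite e.
by move: yn; move: (y * _) => a a0; lra.
Qed.

(** Countably many times keep this event measurable; by continuity they control the
    whole path on [[0, T]]. *)
Definition bounded_by (j : nat) : set Omega :=
  \bigcap_n \bigcap_k [set w | (k <= 2 ^ n)%N -> `|B (grid n k) w| <= j%:R].

Lemma measurable_abs_le t (c : R) : measurable [set w | `|B t w| <= c].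
Proof.
have mi : measurable_fun setT (fun w => `|B t w|) by exact: measurableT_comp.
rewrite (_ : [set w | _] = (fun w => `|B t w|) @^-1` `]-oo, c]%classic).
  by rewrite -[X in measurable X]setTI; exact: mi.
by apply/seteqP; split => w; rewrite /= in_itv/=.
Qed.

Lemma measurable_bounded_by j : measurable (bounded_by j).
Proof.
apply: bigcapT_measurable => n; apply: bigcapT_measurable => k.
have [kn|kn] := boolP (k <= 2 ^ n)%N.
  rewrite (_ : [set w | _] = [set w | `|B (grid n k) w| <= j%:R]).
    exact: measurable_abs_le.
  by apply/seteqP; split => w /=; [exact|].
by rewrite (_ : [set w | _] = setT)//; apply/seteqP; split.
Qed.

Lemma pr_not_bounded_by j : 512 * T <= j%:R ^+ 2 ->
  (P (~` bounded_by j) <= (4 * expR (- (j%:R ^+ 2 / (32 * T))))%:E)%E.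
Proof.
move=> jT; pose y : R := j%:R / 4.
have y0 : 0 <= y by rewrite divr_ge0.
have yT : 32 * T <= y ^+ 2 by rewrite /y; lra.
have -> : j%:R ^+ 2 / (32 * T) = y ^+ 2 / (2 * T).
  by rewrite /y; field; rewrite lt0r_neq0.
apply: le_trans (pr_bad_union y0 yT); apply: le_measure; rewrite ?inE.
- by apply: measurableC; exact: measurable_bounded_by.
- apply: bigcupT_measurable => n; apply: bigsetU_measurable => k _.
  exact: measurable_bad.
move=> w nb; apply: contrapT => nbad; apply: nb => n _ k _ kn.
rewrite (_ : j%:R = 4 * y); last by rewrite /y mulrC divfK.
apply: chaining => // m i im ib; apply: nbad; exists m => //.
by rewrite -bigcup_mkord; exists i.
Qed.

End brownian_maximum.

(** * An integer bound of a Brownian path *)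

Section brownian_bound.
Context {d : measure_display} {Omega : measurableType d} {R : realType}.
Variable P : probability Omega R.
Variable B : R -> {RV P >-> R}.
Hypothesis BM : brownian_motion B.
Variable T : R.
Hypothesis T0 : 0 < T.

Let contB w : {within [set t | 0 <= t], continuous (fun t => B t w)}.
Proof. by case: BM. Qed.

Lemma grid_dense t (e : R) : 0 <= t <= T -> 0 < e ->
  exists n k, (k <= 2 ^ n)%N /\ `|t - grid T n k| < e.
Proof.
move=> /andP[t0 tT] e0.
pose n := Num.bound (T / e).
have nT : T / 2 ^+ n < e.
  have h : T / e < n%:R.
    by apply: le_lt_trans (archi_boundP _) => //; rewrite divr_ge0// ltW.
  have h2 : n%:R <= 2 ^+ n :> R by rewrite -natrX ler_nat ltnW// ltn_expl.
  rewrite ltr_pdivrMr ?exprn_gt0// mulrC -ltr_pdivrMr//.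
  exact: lt_le_trans h h2.
have p0 : 0 < 2 ^+ n :> R by rewrite exprn_gt0.
pose x := t / T * 2 ^+ n.
have x0 : 0 <= x by rewrite mulr_ge0 ?divr_ge0// ltW.
have /andP[x1 x2] := truncn_itv x0.
exists n, (Num.truncn x); split.
  rewrite -(ler_nat R) natrX; apply: (le_trans x1).
  by rewrite /x ler_piMl ?(ltW p0)// ler_pdivrMr// mul1r.
have xE : t = T * (x / 2 ^+ n).
  by rewrite /x mulfK ?lt0r_neq0// mulrC divfK// lt0r_neq0.
rewrite {1}xE /grid -mulrBr -mulrBl ger0_norm; last first.
  by rewrite mulr_ge0 ?(ltW T0)// divr_ge0 ?(ltW p0)// subr_ge0.
apply: le_lt_trans nT; rewrite ler_wpM2l ?(ltW T0)//.
rewrite ler_pdivrMr// mulVf ?lt0r_neq0// lerBlDl natr1.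
exact: ltW.
Qed.

Lemma brownian_eps w t (e : R) : 0 <= t -> 0 < e ->
  exists2 del, 0 < del &
    forall s, 0 <= s -> `|t - s| < del -> `|B t w - B s w| < e.
Proof.
move=> t0 e0.
have /subspace_continuousP/(_ t t0)/cvgrPdist_lt/(_ e e0) := @contB w.
move=> /nbhs_ballP[del del0 h]; exists del => // s s0 ts.
exact: (h s ts s0).
Qed.

Lemma bounded_by_all w j t : bounded_by B T j w -> 0 <= t <= T ->
  `|B t w| <= j%:R.
Proof.
move=> bw tT; have /andP[t0 _] := tT.
rewrite leNgt; apply/negP => jB.
have e0 : 0 < `|B t w| - j%:R by rewrite subr_gt0.
have [del del0 h] := brownian_eps w t0 e0.
have [n [k [kn tk]]] := grid_dense tT del0.
have g0 : 0 <= grid T n k by rewrite mulr_ge0 ?(ltW T0)// divr_ge0// exprn_ge0.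
have := h _ g0 tk; have := bw n I k I kn.
have := ler_normB (B t w - B (grid T n k) w) (- B (grid T n k) w).
by rewrite opprK subrK normrN; lra.
Qed.

Lemma bounded_by_ex w : exists j, bounded_by B T j w.
Proof.
have cT : {within `[0, T], continuous (fun t => B t w)}.
  apply: continuous_subspaceW (@contB w) => t /=.
  by rewrite in_itv/= => /andP[].
have [c1 _ h1] := EVT_max (ltW T0) cT.
have [c2 _ h2] := EVT_min (ltW T0) cT.
exists (Num.bound (`|B c1 w| + `|B c2 w|)) => n _ k _ /= kn.
have gT : grid T n k \in `[0, T].
  rewrite in_itv/= mulr_ge0 ?(ltW T0) ?divr_ge0 ?exprn_ge0//=.
  rewrite /grid ler_piMr ?(ltW T0)// ler_pdivrMr ?exprn_gt0// mul1r -natrX.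
  by rewrite ler_nat.
apply: (@le_trans _ _ (`|B c1 w| + `|B c2 w|)); last first.
  by apply/ltW/(le_lt_trans _ (archi_boundP _)); rewrite ?addr_ge0.
have := h1 _ gT; have := h2 _ gT.
have := ler_norm (B c1 w); have := ler_norm (- B c2 w); rewrite normrN.
have := normr_ge0 (B c1 w); have := normr_ge0 (B c2 w).
by rewrite ler_norml => ? ? ? ? ? ?; apply/andP; split; lra.
Qed.

Lemma bounded_by_mono i j : (i <= j)%N -> bounded_by B T i `<=` bounded_by B T j.
Proof.
by move=> ij w bw n _ k _ kn; apply: (le_trans (bw n I k I kn)); rewrite ler_nat.
Qed.

Let bounded_byb w : exists j, `[< bounded_by B T j w >].
Proof. by have [j bj] := bounded_by_ex w; exists j; apply/asboolP. Qed.

(** An integer, so that the paths enter the conditioning through a discrete variable. *)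
Definition brownian_bound w : nat := ex_minn (bounded_byb w).

Lemma brownian_bound_le w j : (brownian_bound w <= j)%N <-> bounded_by B T j w.
Proof.
rewrite /brownian_bound; case: ex_minnP => m /asboolP bm minm; split.
  by move=> mj; exact: bounded_by_mono bm.
by move=> bj; apply: minm; apply/asboolP.
Qed.

Lemma brownian_boundP w t : 0 <= t <= T -> `|B t w| <= (brownian_bound w)%:R.
Proof. by apply: bounded_by_all; apply/brownian_bound_le. Qed.

Lemma brownian_bound_fiber (G : set_system Omega) k :
  (forall t c, 0 <= t -> <<s G >> [set w | `|B t w| <= c]) ->
  <<s G >> (brownian_bound @^-1` [set k]).
Proof.
move=> GB; have Gb j : <<s G >> (bounded_by B T j).
  apply: (@bigcapT_measurable _ (g_sigma_algebraType G)) => n.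
  apply: (@bigcapT_measurable _ (g_sigma_algebraType G)) => i.
  have [kn|kn] := boolP (i <= 2 ^ n)%N.
    rewrite (_ : [set w | _] = [set w | `|B (grid T n i) w| <= j%:R]).
      by apply: GB; rewrite mulr_ge0 ?(ltW T0)// divr_ge0// exprn_ge0.
    by apply/seteqP; split => w /=; [exact|].
  rewrite (_ : [set w | _] = setT); last by apply/seteqP; split.
  exact: (@measurableT _ (g_sigma_algebraType G)).
have -> : brownian_bound @^-1` [set k] =
    bounded_by B T k `\` (if k is k'.+1 then bounded_by B T k' else set0).
  apply/seteqP; split => w /=.
    move=> <-; split; first exact/brownian_bound_le.
    case E : (brownian_bound w) => [|k'] // bk'.
    by have := (brownian_bound_le w k').2 bk'; rewrite E ltnn.
  move=> [/brownian_bound_le bk nb]; apply/eqP; rewrite eqn_leq bk/=.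
  case: k bk nb => [//|k'] _ nb; rewrite ltnNge; apply/negP => h.
  by apply: nb; apply/brownian_bound_le.
apply: (@measurableD _ (g_sigma_algebraType G)); first exact: Gb.
case: k => [|k']; first exact: (@measurable0 _ (g_sigma_algebraType G)).
exact: Gb.
Qed.

Lemma measurable_brownian_bound k : measurable (brownian_bound @^-1` [set k]).
Proof.
have sE : <<s measurable >> = measurable :> set_system Omega.
  by apply: sigma_algebra_id; exact: sigma_algebra_measurable.
rewrite -sE; apply: brownian_bound_fiber => t c _; rewrite sE.
exact: measurable_abs_le.
Qed.

(** The Gaussian decay is faster than any geometric one; the constant takes care of
    the finitely many [j] for which the Gaussian estimate is not yet available. *)
Lemma pr_brownian_bound_gt (q : R) : 0 < q -> q <= 1 ->
  exists2 K, 0 <= K & forall j,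
    (P [set w | (j < brownian_bound w)%N] <= (K * q ^+ j)%:E)%E.
Proof.
move=> q0 q1; have [m mq] : exists m : nat, expR (- (m%:R / (32 * T))) <= q.
  exists (Num.bound (32 * T * (- ln q))).
  rewrite -[leRHS](lnK q0) ler_expR lerNl.
  rewrite ler_pdivlMr ?mulr_gt0// mulrC ltW//; apply: le_lt_trans (archi_boundP _) => //.
  by rewrite mulr_ge0 ?mulr_ge0 ?(ltW T0)// oppr_ge0 ln_le0.
have [m2 hm2] : exists m2 : nat, 512 * T <= m2%:R.
  have : 0 <= 512 * T by apply: mulr_ge0; [exact: ler0n|exact: ltW].
  move: (512 * T) => c c0; exists (Num.bound c).
  exact/ltW/(le_lt_trans _ (archi_boundP c0)).
pose j0 := maxn m m2.
exists (4 + (q ^+ j0)^-1); first by rewrite addr_ge0// invr_ge0 exprn_ge0// ltW.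
move=> j.
have qj : 0 <= q ^+ j by rewrite exprn_ge0// ltW.
have -> : [set w | (j < brownian_bound w)%N] = ~` bounded_by B T j.
  apply/seteqP; split => w /=; first by move=> jb /brownian_bound_le; rewrite leqNgt jb.
  by move=> nb; rewrite ltnNge; apply/negP => /brownian_bound_le.
have mnb : measurable (~` bounded_by B T j).
  by apply: measurableC; exact: measurable_bounded_by.
have [jj0|j0j] := leqP j j0.
  apply: (le_trans (probability_le1 P mnb)); rewrite lee_fin [leRHS]mulrDl.
  apply: (@le_trans _ _ ((q ^+ j0)^-1 * q ^+ j)); last by rewrite lerDr mulr_ge0.
  rewrite mulrC ler_pdivlMr ?exprn_gt0// mul1r.
  by apply: ler_wiXn2l => //; exact: ltW.
have mj : (m <= j)%N by apply: leq_trans (ltnW j0j); exact: leq_maxl.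
have j512 : 512 * T <= j%:R ^+ 2.
  apply: (@le_trans _ _ (j%:R)).
    apply: (le_trans hm2).
    by rewrite ler_nat; apply: leq_trans (ltnW j0j); exact: leq_maxr.
  by rewrite expr2 ler_peMl// ler1n; apply: leq_ltn_trans j0j.
apply: (le_trans (pr_not_bounded_by BM T0 j512)).
rewrite lee_fin; apply: (@le_trans _ _ (4 * q ^+ j)); last first.
  by rewrite [leRHS]mulrDl lerDl mulr_ge0// invr_ge0 exprn_ge0// ltW.
rewrite ler_wpM2l//.
apply: (@le_trans _ _ (expR (- (m%:R / (32 * T))) ^+ j)); last first.
  by rewrite lerXn2r// nnegrE ?expR_ge0// ltW.
rewrite -expRM_natl ler_expR mulrN lerN2 mulrA ler_wpM2r//.
  by rewrite invr_ge0 mulr_ge0// ltW.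
by rewrite expr2 ler_wpM2l// ler_nat.
Qed.

Lemma brownian_bound_exp_moment (r : R) : 0 <= r ->
  (\int[P]_w (r ^+ brownian_bound w)%:E < +oo)%E.
Proof.
move=> r0; pose p := r + 1; have p0 : 0 < p by rewrite ltr_wpDl.
have p1 : 1 <= p by rewrite lerDr.
have mb := measurable_brownian_bound.
(* This ratio makes [p ^+ j * q ^+ j] summable. *)
pose q := (p * 2)^-1; have q0 : 0 < q by rewrite invr_gt0 mulr_gt0.
have q1 : q <= 1 by rewrite invf_le1 ?mulr_gt0//; lra.
have [K K0 hK] := pr_brownian_bound_gt q0 q1.
apply: (@le_lt_trans _ _ (\int[P]_w (p ^+ brownian_bound w)%:E)%E).
  apply: ge0_le_integral => //.
  - by move=> w _; rewrite lee_fin exprn_ge0.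
  - by apply/measurable_EFinP; exact: (measurable_discrete mb (fun k => r ^+ k : R)).
  - by apply/measurable_EFinP; exact: (measurable_discrete mb (fun k => p ^+ k : R)).
  - by move=> w _; rewrite lee_fin lerXn2r// ?nnegrE ?(ltW p0)// /p lerDl.
rewrite (integral_nat P mb (f := fun k => (p ^+ k)%:E)); last first.
  by move=> k; rewrite lee_fin exprn_ge0// ltW.
pose C := 2 * (1 + K * p * 2).
apply: (@le_lt_trans _ _ C%:E); last exact: ltry.
have C0 : 0 <= C by rewrite /C mulr_ge0// addr_ge0// !mulr_ge0// ltW.
apply: le_trans (epsilon_trick0 xpredT C0).
apply: lee_nneseries => [k _|k _].
  by rewrite mule_ge0// lee_fin exprn_ge0// ltW.
case: k => [|k].
  rewrite expr0 mul1e expn1; apply: (le_trans (probability_le1 P (mb _))).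
  rewrite lee_fin /C mulrAC divff// mul1r lerDl.
  by rewrite !mulr_ge0// ltW.
apply: (@le_trans _ _ ((p ^+ k.+1)%:E * (K * q ^+ k)%:E)%E).
  apply: lee_wpmul2l; first by rewrite lee_fin exprn_ge0// ltW.
  apply: le_trans (hK k); apply: le_measure; rewrite ?inE//.
    exact: (measurable_discrete_preimage mb [set j | (k < j)%N]).
  by move=> w /= ->.
rewrite -EFinM lee_fin /q invfM exprMn !exprVn natrX exprS ![in leRHS]exprS.
have := expf_neq0 k (lt0r_neq0 p0).
have h2 : 0 < 2 ^+ k :> R by rewrite exprn_gt0.
have := lt0r_neq0 h2; move: h2; rewrite /C; move: (p ^+ k) (2 ^+ k) => a b b0 bn an.
rewrite -subr_ge0 (_ : _ - _ = 2^-1 / b); last by field; rewrite bn an.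
by rewrite divr_ge0 ?invr_ge0// ltW.
Qed.

End brownian_bound.

(** * Ruin times of right-continuous paths *)

Section ruin_time_paths.
Context {d : measure_display} {Omega : measurableType d} {R : realType}.
Implicit Types V : R -> Omega -> R.

Lemma right_continuous_eps V w t (e : R) : right_continuous_paths V -> 0 <= t ->
  0 < e -> exists2 del, 0 < del & forall s, t <= s < t + del -> `|V t w - V s w| < e.
Proof.
move=> rV t0 e0; have /cvgrPdist_lt/(_ e e0) := rV w t t0.
move=> /nbhs_ballP[del del0 h]; exists del => // s /andP[ts sd].
move: ts; rewrite le_eqVlt => /orP[/eqP <-|ts]; first by rewrite subrr normr0.
have ts' : `|t - s| < del by rewrite distrC gtr0_norm ?subr_gt0// ltrBlDl.
exact: (h s ts' ts).
Qed.

Lemma ruin_time_lt V w (T : R) : 0 < T -> V T w < 0 -> (ruin_time V w <= T%:E)%E.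
Proof. by move=> T0 VT; apply: ereal_inf_lbound; exists T. Qed.

(** If the path were positive on all of [(0, T]], right continuity at [T] would keep it
    positive a little longer, and the infimum would exceed [T]. At the infimum itself
    the value may be [0], hence the weak inequality. *)
Lemma ruin_time_attained V w (T : R) : right_continuous_paths V -> 0 < T ->
  (ruin_time V w <= T%:E)%E -> exists t, 0 < t <= T /\ V t w <= 0.
Proof.
move=> rV T0 rT; apply: contrapT => nt.
have pos t : 0 < t <= T -> 0 < V t w.
  by move=> tT; rewrite ltNge; apply/negP => Vt; apply: nt; exists t.
have VT : 0 < V T w by apply: pos; rewrite T0 lexx.
have [del del0 h] := right_continuous_eps w rV (ltW T0) VT.
have : ((T + del)%:E <= ruin_time V w)%E.
  apply: le_ereal_inf_tmp => _ [t [t0 Vt] <-]; rewrite lee_fin leNgt; apply/negP => tT.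
  have [tle|Tt] := leP t T.
    by have := pos t; rewrite t0 tle => /(_ isT); rewrite ltNge (ltW Vt).
  have := h t; rewrite (ltW Tt) tT => /(_ isT); rewrite gtr0_norm; lra.
by move=> /le_trans/(_ rT); rewrite lee_fin gerDl leNgt del0.
Qed.

(** The ruin time is at most [T] when ruin occurs before [T + 1 / (n + 1)] for all
    [n], and by right continuity a negative value persists up to a rational time. *)
Lemma measurable_ruin_time V (T : R) : right_continuous_paths V -> 0 < T ->
  (forall t, 0 <= t -> measurable_fun setT (V t)) ->
  measurable [set w | (ruin_time V w <= T%:E)%E].
Proof.
move=> rV T0 mV.
have -> : [set w | (ruin_time V w <= T%:E)%E] = \bigcap_n \bigcup_(q : rat)
    [set w | 0 < (ratr q : R) < T + n.+1%:R^-1 /\ V (ratr q) w < 0].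
  apply/seteqP; split => w /=.
    move=> rT n _.
    have : (ruin_time V w < (T + n.+1%:R^-1)%:E)%E.
      by apply: (le_lt_trans rT); rewrite lte_fin ltrDl invr_gt0.
    move=> /ereal_inf_lt[_ [t [t0 Vt] <-]]; rewrite lte_fin => tT.
    have Vt0 : 0 < - V t w by rewrite oppr_gt0.
    have [del del0 h] := right_continuous_eps w rV (ltW t0) Vt0.
    have tm : t < Num.min (t + del) (T + n.+1%:R^-1) by rewrite lt_min tT ltrDl del0.
    have [q] := rat_in_itvoo tm.
    rewrite in_itv/= lt_min => /andP[tq /andP[qd qT]]; exists q => //=; split.
      by rewrite qT (lt_trans t0 tq).
    have := h (ratr q); rewrite (ltW tq) qd => /(_ isT).
    by rewrite ltr_norml => /andP[] ; lra.
  move=> h; apply/lee_addgt0Pr => e e0.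
  have [n ne] : exists n : nat, n.+1%:R^-1 < e.
    exists (Num.bound e^-1); rewrite -[ltRHS]invrK ltf_pV2 ?posrE ?invr_gt0//.
    apply: lt_trans (archi_boundP _) _; first by rewrite invr_ge0 ltW.
    by rewrite ltr_nat.
  have [q _ /= [/andP[q0 qT] Vq]] := h n I.
  apply: (@le_trans _ _ (ratr q)%:E); first exact: ruin_time_lt.
  by rewrite -EFinD lee_fin; apply/ltW/(lt_trans qT); rewrite ltrD2l.
apply: bigcapT_measurable => n; apply: bigcupT_measurable_rat => q.
have [q0|q0] := boolP (0 < (ratr q : R) < T + n.+1%:R^-1); last first.
  by rewrite (_ : [set w | _] = set0)//; apply/seteqP; split => // w [].
rewrite (_ : [set w | _] = V (ratr q) @^-1` `]-oo, 0[%classic).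
  rewrite -[X in measurable X]setTI; apply: mV => //.
  by apply: ltW; case/andP: q0.
by apply/seteqP; split => w /=; rewrite in_itv/= => -[].
Qed.

End ruin_time_paths.

Section surplus_paths.
Context {d : measure_display} {Omega : measurableType d} {R : realType}.
Variable P : probability Omega R.
Variables (u sigma lambda : R) (C B : R -> {RV P >-> R}) (X : nat -> {RV P >-> R})
  (N : R -> {RV P >-> nat}).
Hypothesis Cprem : premium_process C.
Hypothesis Npois : poisson_process lambda N.
Hypothesis BM : brownian_motion B.
Hypothesis X_ge0 : forall k w, 0 <= X k w.
Hypothesis sigma0 : 0 <= sigma.

Let U := surplus u C X N sigma B.

Lemma surplus_right_continuous : right_continuous_paths U.
Proof.
move=> w t t0; have [_ [_ rN] _ _] := Npois; have [_ _ _ rC] := Cprem.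
rewrite /U /surplus; apply: cvgD; first apply: cvgB.
- by apply: cvgD; [exact: cvg_cst|exact: rC].
- apply: cvg_near_cst.
  have [del del0 h] := right_continuous_eps w rN t0 ltr01.
  near=> s; have ts : t <= s < t + del.
    apply/andP; split; first by near: s; exact: nbhs_right_ge.
    by near: s; apply: nbhs_right_lt; rewrite ltrDl.
  suff -> : N s w = N t w by [].
  have := h s ts; apply: contraTeq; rewrite -leNgt neq_ltn => /orP[] NN.
    rewrite ger0_norm ?subr_ge0 ?ler_nat ?(ltnW NN)//.
    by rewrite lerBrDl natr1 ler_nat.
  rewrite distrC ger0_norm ?subr_ge0 ?ler_nat ?(ltnW NN)//.
  by rewrite lerBrDl natr1 ler_nat.
- apply: cvgM; first exact: cvg_cst.
  apply/cvgrPdist_lt => e e0; have [del del0 h] := brownian_eps BM w t0 e0.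
  near=> s; have ts : t <= s by near: s; exact: nbhs_right_ge.
  apply: h; first exact: le_trans ts.
  rewrite distrC ger0_norm ?subr_ge0// ltrBlDl.
  by near: s; apply: nbhs_right_lt; rewrite ltrDl.
Unshelve. all: by end_near. Qed.

Lemma measurable_surplus t : measurable_fun setT (U t).
Proof.
have mN k : measurable (N t @^-1` [set k]).
  by rewrite -[X in measurable X]setTI; exact: measurable_funP.
have mS : measurable_fun setT (fun w => \sum_(k < N t w) X k w).
  move=> _ A mA; rewrite setTI.
  apply: (measurable_discrete_event mN
    (A := fun n => (fun w => \sum_(k < n) X k w) @^-1` A)) => n.
  rewrite -[X in measurable X]setTI.
  by apply: measurable_sum => // k.
apply: measurable_funD; first by apply: measurable_funB => //; exact: measurable_funD.
exact: measurable_funM.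
Qed.

Let sum_mono w m n : (m <= n)%N -> \sum_(k < m) X k w <= \sum_(k < n) X k w.
Proof.
move=> mn; rewrite -!(big_mkord xpredT (fun k => X k w)).
rewrite (big_cat_nat (n := m) (p := n))//= lerDl.
by apply: sumr_ge0 => k _.
Qed.

(** Premiums can only delay ruin, and the claims up to time [t] are among the claims
    up to [T]. *)
Lemma claims_ge_surplus w t T (b : R) : 0 < t <= T ->
  (forall s, 0 <= s <= T -> `|B s w| <= b) ->
  u - sigma * b - U t w <= \sum_(k < N T w) X k w.
Proof.
move=> /andP[t0 tT] Bb; have [_ C0 _ _] := Cprem; have [_ [incN _] _ _] := Npois.
have Ntt : (N t w <= N T w)%N by have := incN w t T (ltW t0) tT; rewrite ler_nat.
have := sum_mono w Ntt; have := C0 w t (ltW t0).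
have : - (sigma * b) <= sigma * B t w.
  rewrite -mulrN ler_wpM2l// lerNl; apply: le_trans (Bb t _); last by rewrite (ltW t0).
  by rewrite -normrN ler_norm.
by rewrite /U /surplus; lra.
Qed.

Lemma surplus_le_claims w T (b c : R) : `|B T w| <= b -> C T w <= c ->
  U T w <= u + c + sigma * b - \sum_(k < N T w) X k w.
Proof.
move=> Bb Cc.
have : sigma * B T w <= sigma * b.
  by rewrite ler_wpM2l//; apply: le_trans Bb; exact: ler_norm.
by rewrite /U /surplus; lra.
Qed.

End surplus_paths.

Section cvg_max_min.
Context {R : realType} {I : Type} (F : set_system I) {FF : Filter F}.
Variables (f g : I -> R) (a b : R).
Hypotheses (fa : f x @[x --> F] --> a) (gb : g x @[x --> F] --> b).

Lemma cvgr_max : Num.max (f x) (g x) @[x --> F] --> Num.max a b.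
Proof.
rewrite maxr_absE; under eq_fun do rewrite maxr_absE.
apply: cvgM; last exact: cvg_cst.
by apply: cvgD; [exact: cvgD|apply: cvg_norm; exact: cvgB].
Qed.

Lemma cvgr_min : Num.min (f x) (g x) @[x --> F] --> Num.min a b.
Proof.
rewrite minr_absE; under eq_fun do rewrite minr_absE.
apply: cvgM; last exact: cvg_cst.
by apply: cvgB; [exact: cvgD|apply: cvg_norm; exact: cvgB].
Qed.

End cvg_max_min.

(** * Consequences of the independence of the six sources of randomness *)

Section sigma_processes.
Context {d : measure_display} {Omega : measurableType d} {R : realType}.
Variable P : probability Omega R.

Section one_process.
Context {d' : measure_display} {U : measurableType d'} {I : Type} (D : set I)
  (Y : I -> Omega -> U).

Lemma sigma_process_rv i A : D i -> measurable A -> sigma_process D Y (Y i @^-1` A).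
Proof.
by move=> Di mA; apply: sub_sigma_algebra; exists i => //; exact: sigma_rvP.
Qed.

Lemma sigma_process_measurable : (forall i, D i -> measurable_fun setT (Y i)) ->
  sigma_process D Y `<=` measurable.
Proof.
move=> mY; apply: smallest_sub; first exact: sigma_algebra_measurable.
by move=> _ [i Di [A mA <-]]; exact: mY.
Qed.

Lemma sigma_processT : sigma_process D Y setT.
Proof. exact: (@measurableT _ (g_sigma_algebraType _)). Qed.

Lemma sigma_processI A B : sigma_process D Y A -> sigma_process D Y B ->
  sigma_process D Y (A `&` B).
Proof. exact: (@measurableI _ (g_sigma_algebraType _)). Qed.

End one_process.

Lemma sigma_process_sum (X : nat -> Omega -> R) n A : measurable A ->
  sigma_process setT X ((fun w => \sum_(k < n) X k w) @^-1` A).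
Proof.
move=> mA; pose G := \bigcup_(i in [set: nat]) sigma_rv (X i).
have mX k : @measurable_fun _ _ (g_sigma_algebraType G) R setT (X k).
  by move=> _ B mB; rewrite setTI; exact: sigma_process_rv.
have := @measurable_sum _ (g_sigma_algebraType G) R setT _ (enum 'I_n)
  (fun k w => X k w) (fun k => mX k).
move=> /(_ measurableT A mA); rewrite setTI.
by under eq_fun do rewrite big_enum.
Qed.

Arguments sigma_processT {d' U I} D Y.

Lemma mutual_indep_six (G0 G1 G2 G3 G4 G5 : set_system Omega) :
  mutual_indep P (fun i : 'I_6 => nth set0 [:: G0; G1; G2; G3; G4; G5] i) ->
  forall A0 A1 A2 A3 A4 A5, G0 A0 -> G1 A1 -> G2 A2 -> G3 A3 -> G4 A4 -> G5 A5 ->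
  P (A0 `&` A1 `&` A2 `&` A3 `&` A4 `&` A5) =
  (pr P A0 * pr P A1 * pr P A2 * pr P A3 * pr P A4 * pr P A5)%:E.
Proof.
move=> ind A0 A1 A2 A3 A4 A5 H0 H1 H2 H3 H4 H5.
pose A (i : 'I_6) : set Omega := nth set0 [:: A0; A1; A2; A3; A4; A5] i.
pose J : {fset 'I_6} := [fset i | i in enum 'I_6]%fset.
have inJ i : i \in J by apply/imfsetP; exists i => //=; rewrite mem_enum.
have := ind J A; rewrite (_ : \bigcap_(i in _) _ = A0 `&` A1 `&` A2 `&` A3 `&` A4 `&` A5).
  move=> ->; last by case=> -[|[|[|[|[|[|//]]]]]] h _.
  congr (_%:E); rewrite (perm_big (enum 'I_6)); last first.
    apply: uniq_perm; rewrite ?fset_uniq ?enum_uniq// => i.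
    by rewrite inJ mem_enum.
  by rewrite big_enum !big_ord_recl big_ord0 /A /= mulr1 !mulrA.
apply/seteqP; split => w /=.
  move=> h; split; [split; [split; [split; [split|]|]|]|].
  - exact: (h (@Ordinal 6 0 isT) (inJ _)).
  - exact: (h (@Ordinal 6 1 isT) (inJ _)).
  - exact: (h (@Ordinal 6 2 isT) (inJ _)).
  - exact: (h (@Ordinal 6 3 isT) (inJ _)).
  - exact: (h (@Ordinal 6 4 isT) (inJ _)).
  - exact: (h (@Ordinal 6 5 isT) (inJ _)).
by move=> [[[[[? ?] ?] ?] ?] ?] [[|[|[|[|[|[|//]]]]]] h] _.
Qed.

End sigma_processes.

Arguments sigma_processT {d Omega d' U I} D Y.

(** When [a] and [b] are close to [m], the sum [a * f + b * g] is close to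
    [m * (f + g)] relative to [f + g], whatever the ratio of the weights [f] and [g]. *)
Section weighted_means.
Context {R : realFieldType}.
Variables (a b m f g : R).
Hypotheses (f0 : 0 <= f) (g0 : 0 <= g).

Lemma weighted_upper : a * f + b * g <= (m + `|a - m| + `|b - m|) * (f + g).
Proof.
have := ler_norm (a - m); have := ler_norm (b - m).
have := normr_ge0 (a - m); have := normr_ge0 (b - m).
move: (`|a - m|) (`|b - m|) => x y y0 x0 bm am; rewrite -subr_ge0.
rewrite (_ : _ - _ = (m + x - a) * f + y * f + ((m + y - b) * g + x * g)); last by ring.
by rewrite !addr_ge0// mulr_ge0//; lra.
Qed.

Lemma weighted_lower e : 0 <= e ->
  (m - `|a - m| - `|b - m| - e) * (f + g) <= a * f + b * g - e * g.
Proof.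
move=> e0; have := ler_norm (- (a - m)); have := ler_norm (- (b - m)).
rewrite !normrN; have := normr_ge0 (a - m); have := normr_ge0 (b - m).
move: (`|a - m|) (`|b - m|) => x y y0 x0 bm am; rewrite -subr_ge0.
rewrite (_ : _ - _ = (a - m + x) * f + y * f + ((b - m + y) * g + x * g) + e * f);
  last by ring.
by rewrite !addr_ge0// mulr_ge0//; lra.
Qed.

End weighted_means.

(** * The risk model *)

Section risk_model.
Context (R : realType) (d : measure_display)
    (Omega : measurableType d) (P : probability Omega R).
Variables (lambda sigma1 sigma2 : R)
    (X1 X2 : nat -> {RV P >-> R})
    (C1 C2 : R -> {RV P >-> R})
    (N : R -> {RV P >-> nat})
    (B1 B2 : R -> {RV P >-> R}).
Hypotheses (lambda_gt0 : 0 < lambda)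
    (sigma1_ge0 : 0 <= sigma1) (sigma2_ge0 : 0 <= sigma2)
    (X_ge0 : forall k omega, 0 <= X1 k omega /\ 0 <= X2 k omega)
    (X_iid : iid P (fun k omega => (X1 k omega, X2 k omega)))
    (C1_premium : premium_process C1) (C2_premium : premium_process C2)
    (N_poisson : poisson_process lambda N)
    (BM1 : brownian_motion B1) (BM2 : brownian_motion B2).

Let GX1 := sigma_process [set: nat] (fun k omega => X1 k omega).
Let GX2 := sigma_process [set: nat] (fun k omega => X2 k omega).
Let GC1 := sigma_process [set t : R | 0 <= t] (fun t omega => C1 t omega).
Let GC2 := sigma_process [set t : R | 0 <= t] (fun t omega => C2 t omega).
Let GN := sigma_process [set t : R | 0 <= t] (fun t omega => N t omega).
Let GB := sigma_process [set t : R | 0 <= t]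
            (fun t omega => (B1 t omega, B2 t omega)).

Hypothesis indep : mutual_indep P
  (fun i : 'I_6 => nth set0 [:: GX1; GX2; GC1; GC2; GN; GB] i).

Variable T : R.
Hypothesis T0 : 0 < T.
Let mu := lambda * T.
Let mu0 : 0 < mu. Proof. exact: mulr_gt0. Qed.

(** Everything but the claims enters the bounds only through these integers:
    the claim number, the integer parts of the premiums, and the bounds of the two
    Brownian paths. *)
Let index := ((nat * (nat * nat)) * (nat * nat))%type.
Let b1 := brownian_bound BM1 T0.
Let b2 := brownian_bound BM2 T0.
Let c1 w := Num.truncn (C1 T w).
Let c2 w := Num.truncn (C2 T w).
Let V w : index := ((N T w, (c1 w, c2 w)), (b1 w, b2 w)).

Let T_ge0 : [set t | 0 <= t] T. Proof. exact: ltW. Qed.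

Lemma premium_fiber (C : R -> {RV P >-> R}) k : premium_process C ->
  sigma_process [set t : R | 0 <= t] (fun t omega => C t omega)
    ((fun w => Num.truncn (C T w)) @^-1` [set k]).
Proof.
move=> [_ C0 _ _].
rewrite (_ : _ @^-1` _ = C T @^-1` `[k%:R, k.+1%:R[%classic).
  exact: (sigma_process_rv (Y := fun t omega => C t omega)).
apply/seteqP; split => w /=; rewrite in_itv/= -truncn_eq ?C0 ?ltW//; first by move=> ->.
by move=> /eqP.
Qed.

Let measurable_norm_le (c : R) : measurable [set x : R | `|x| <= c].
Proof.
rewrite (_ : [set x | _] = `[- c, c]%classic); first exact: measurable_itv.
by apply/seteqP; split => x; rewrite /= in_itv/= ler_norml.
Qed.

Let b1_fiber k : GB (b1 @^-1` [set k]).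
Proof.
apply: brownian_bound_fiber => t c t0.
apply: (sigma_process_rv (Y := fun t omega => (B1 t omega, B2 t omega))
  (A := fst @^-1` [set x | `|x| <= c])) => //.
by rewrite -[X in measurable X]setTI; apply: measurable_fst.
Qed.

Let b2_fiber k : GB (b2 @^-1` [set k]).
Proof.
apply: brownian_bound_fiber => t c t0.
apply: (sigma_process_rv (Y := fun t omega => (B1 t omega, B2 t omega))
  (A := snd @^-1` [set x | `|x| <= c])) => //.
by rewrite -[X in measurable X]setTI; apply: measurable_snd.
Qed.

Let V_fiber v : V @^-1` [set v] =
  (c1 @^-1` [set v.1.2.1]) `&` (c2 @^-1` [set v.1.2.2]) `&` (N T @^-1` [set v.1.1])
  `&` (b1 @^-1` [set v.2.1] `&` b2 @^-1` [set v.2.2]).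
Proof.
case: v => -[n [i1 i2]] [j1 j2]; apply/seteqP; split => w /=.
  by case.
by move=> [[[]]]; rewrite /V => -> -> -> [-> ->].
Qed.

Let GX1m : GX1 `<=` measurable.
Proof. by apply: sigma_process_measurable => k _; exact: measurable_funP. Qed.

Let GX2m : GX2 `<=` measurable.
Proof. by apply: sigma_process_measurable => k _; exact: measurable_funP. Qed.

Let GNf k : GN (N T @^-1` [set k]).
Proof. exact: (sigma_process_rv (Y := fun t omega => N t omega)). Qed.

Let mV v : measurable (V @^-1` [set v]).
Proof.
rewrite V_fiber; apply: measurableI.
  apply: measurableI.
    apply: measurableI.
      apply: (sigma_process_measurable _ (premium_fiber v.1.2.1 C1_premium)) => t _.
      exact: measurable_funP.
    apply: (sigma_process_measurable _ (premium_fiber v.1.2.2 C2_premium)) => t _.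
    exact: measurable_funP.
  by rewrite -[X in measurable X]setTI; exact: measurable_funP.
by apply: measurableI; exact: measurable_brownian_bound.
Qed.

Let indepV E1 E2 v : GX1 E1 -> GX2 E2 ->
  (P (E1 `&` E2 `&` V @^-1` [set v]) = P E1 * P E2 * P (V @^-1` [set v]))%E.
Proof.
move=> H1 H2; rewrite V_fiber (prE (GX1m H1)) (prE (GX2m H2)).
have six := fun E1 E2 H1 H2 => mutual_indep_six indep (A0 := E1) (A1 := E2) H1 H2
  (premium_fiber v.1.2.1 C1_premium) (premium_fiber v.1.2.2 C2_premium) (GNf v.1.1)
  (sigma_processI (b1_fiber v.2.1) (b2_fiber v.2.2)).
have := six setT setT (sigma_processT _ _) (sigma_processT _ _).
rewrite !setTI prT !mul1r => ->.
have := six _ _ H1 H2; rewrite -!/(c1 @^-1` _) -!/(c2 @^-1` _) !setIA => ->.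
by rewrite -!EFinM !mulrA.
Qed.

Let F1 : probability R R := distribution P (X1 0%N).
Let F2 : probability R R := distribution P (X2 0%N).

Let X1_law k A : measurable A -> P (X1 k @^-1` A) = F1 A.
Proof.
move=> mA; have [_ /(_ k (A `*` setT))] := X_iid.
have -> : (fun w => (X1 k w, X2 k w)) @^-1` (A `*` setT) = X1 k @^-1` A.
  by apply/seteqP; split => w /= => [[]|].
have -> : (fun w => (X1 0%N w, X2 0%N w)) @^-1` (A `*` setT) = X1 0%N @^-1` A.
  by apply/seteqP; split => w /= => [[]|].
by apply; exact: measurableX.
Qed.

Let X2_law k A : measurable A -> P (X2 k @^-1` A) = F2 A.
Proof.
move=> mA; have [_ /(_ k (setT `*` A))] := X_iid.
have -> : (fun w => (X1 k w, X2 k w)) @^-1` (setT `*` A) = X2 k @^-1` A.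
  by apply/seteqP; split => w /= => [[]|].
have -> : (fun w => (X1 0%N w, X2 0%N w)) @^-1` (setT `*` A) = X2 0%N @^-1` A.
  by apply/seteqP; split => w /= => [[]|].
by apply; exact: measurableX.
Qed.

Let iid_comp (f : R * R -> R) : measurable_fun setT f ->
  mutual_indep P (fun k => sigma_rv (fun w => f (X1 k w, X2 k w))).
Proof.
move=> mf; have [ind _] := X_iid; apply: mutual_indep_sub ind => k.
exact: (sigma_rv_comp (Y := fun w => (X1 k w, X2 k w)) mf).
Qed.

Let S1 n w := \sum_(k < n) X1 k w.
Let S2 n w := \sum_(k < n) X2 k w.

Let S1_law n A : measurable A -> P (S1 n @^-1` A) = conv_pow F1 n A.
Proof.
apply: (iid_sum_law (Y := fun k w => X1 k w)) => //.
exact: (iid_comp measurable_fst).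
Qed.

Let S2_law n A : measurable A -> P (S2 n @^-1` A) = conv_pow F2 n A.
Proof.
apply: (iid_sum_law (Y := fun k w => X2 k w)) => //.
exact: (iid_comp measurable_snd).
Qed.

Let S_indepV n v A B : measurable A -> measurable B ->
  (P (S1 n @^-1` A `&` S2 n @^-1` B `&` V @^-1` [set v]) =
   conv_pow F1 n A * conv_pow F2 n B * P (V @^-1` [set v]))%E.
Proof.
move=> mA mB; rewrite indepV; first by rewrite S1_law// S2_law.
  exact: sigma_process_sum.
exact: sigma_process_sum.
Qed.

Let Z k w := X1 k w + X2 k w.
Let H : probability R R := convolution F1 F2.

Let SZ n w := \sum_(k < n) Z k w.

Let SE n w : SZ n w = S1 n w + S2 n w.
Proof. by rewrite /SZ /S1 /S2 -big_split. Qed.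

Let mS1 n : measurable_fun setT (S1 n).
Proof. by apply: measurable_sum => k; exact: measurable_funP. Qed.

Let mS2 n : measurable_fun setT (S2 n).
Proof. by apply: measurable_sum => k; exact: measurable_funP. Qed.

Let indep_claims E1 E2 : GX1 E1 -> GX2 E2 -> (P (E1 `&` E2) = P E1 * P E2)%E.
Proof.
move=> H1 H2.
have := mutual_indep_six indep H1 H2 (sigma_processT _ _) (sigma_processT _ _)
  (sigma_processT _ _) (sigma_processT _ _).
rewrite !setIT !prT !mulr1 => ->.
by rewrite (prE (GX1m H1)) (prE (GX2m H2)).
Qed.

Let Z_law k A : measurable A -> P (Z k @^-1` A) = H A.
Proof.
move=> mA.
have := @pair_law _ _ _ P _ _ _ _ (fun w => X1 k w) (fun w => X2 k w) F1 F2 setT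
  (measurable_funP _) (measurable_funP _) measurableT.
have mC : measurable (Defs.add_pair (R:=R) @^-1` A).
  by rewrite -[X in measurable X]setTI; exact: measurable_funP.
move=> /(_ _ _ mC); rewrite setIT probability_setT mule1; apply.
move=> B D mB mD; rewrite setIT mule1 indep_claims ?X1_law ?X2_law//.
  exact: (sigma_process_rv (Y := fun k omega => X1 k omega)).
exact: (sigma_process_rv (Y := fun k omega => X2 k omega)).
Qed.

Let SZ_law n A : measurable A ->
  P (SZ n @^-1` A) = conv_pow H n A.
Proof.
apply: (iid_sum_law (Y := Z)) => //.
  by move=> k; exact: measurable_funD.
exact: (iid_comp (measurable_funD measurable_fst measurable_snd)).
Qed.

Let tail_gt (F : probability R R) x : F `]x, +oo[%classic = (tail F x)%:E.
Proof. by rewrite tailE -prE. Qed.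

Let S1V n v x : (P (S1 n @^-1` `]x, +oo[ `&` V @^-1` [set v]) =
  (tail (conv_pow F1 n) x)%:E * P (V @^-1` [set v]))%E.
Proof.
have := @S_indepV n v `]x, +oo[%classic setT (measurable_itv _) measurableT.
by rewrite preimage_setT setIT probability_setT mule1 tail_gt.
Qed.

Let S2V n v x : (P (S2 n @^-1` `]x, +oo[ `&` V @^-1` [set v]) =
  (tail (conv_pow F2 n) x)%:E * P (V @^-1` [set v]))%E.
Proof.
have := @S_indepV n v setT `]x, +oo[%classic measurableT (measurable_itv _).
by rewrite preimage_setT setTI probability_setT mul1e tail_gt.
Qed.

(** Conditionally on [V] the pair of claim sums has the product of its marginal laws;
    the same holds unconditionally, where the sum has law [conv_pow H n]. *)
Let SZV n v x : (P (SZ n @^-1` `]x, +oo[ `&` V @^-1` [set v]) =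
  (tail (conv_pow H n) x)%:E * P (V @^-1` [set v]))%E.
Proof.
rewrite -tail_gt -SZ_law//.
have eZ : SZ n @^-1` `]x, +oo[ =
    (fun w => (S1 n w, S2 n w)) @^-1` sum_above x.
  by apply/seteqP; split => w; rewrite /sum_above /= SE in_itv/= andbT.
rewrite eZ (pair_law (mu := conv_pow F1 n) (nu := conv_pow F2 n))//; last 2 first.
- by move=> A B mA mB; exact: S_indepV.
- exact: measurable_sum_above.
congr (_ * _)%E; have := @pair_law _ _ _ P _ _ _ _ (S1 n) (S2 n)
  (conv_pow F1 n) (conv_pow F2 n) setT (mS1 n) (mS2 n) measurableT.
move=> /(_ _ _ (measurable_sum_above x)); rewrite setIT probability_setT mule1 => -> //.
move=> A B mA mB; rewrite setIT mule1 indep_claims ?S1_law ?S2_law//.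
  exact: sigma_process_sum.
exact: sigma_process_sum.
Qed.

Let n (v : index) := v.1.1.
Let i1 (v : index) := v.1.2.1.
Let i2 (v : index) := v.1.2.2.
Let j1 (v : index) := v.2.1.
Let j2 (v : index) := v.2.2.

Let mN k : measurable (N T @^-1` [set k]).
Proof. by rewrite -[X in measurable X]setTI; exact: measurable_funP. Qed.

Let PN k : P (N T @^-1` [set k]) = (poisson_pmf mu k)%:E.
Proof.
have [N0 _ _ /(_ 0 T k (lexx _) T0)] := N_poisson; rewrite subr0 => <-.
by congr (P _); apply/seteqP; split => w /=; rewrite N0 add0n.
Qed.

Let n_exp (r : R) : 0 <= r -> finite_mean P V (fun v => r ^+ n v).
Proof. exact: (poisson_exp_moment mu0 mN PN). Qed.

Let exp_affine (j : index -> nat) (m : nat) :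
  (forall r : R, 0 <= r -> finite_mean P V (fun v => r ^+ j v)) ->
  forall r : R, 0 <= r -> finite_mean P V (fun v => r ^+ (m * j v).+1).
Proof.
move=> jexp r r0; rewrite /finite_mean; under eq_integral do rewrite exprS exprM.
apply: (finite_meanZ mV (f := fun v => (r ^+ m) ^+ j v)) => // [v|].
  by rewrite !exprn_ge0.
by apply: jexp; rewrite exprn_ge0.
Qed.

Let j1_exp (r : R) : 0 <= r -> finite_mean P V (fun v => r ^+ j1 v).
Proof. exact: brownian_bound_exp_moment. Qed.

Let j2_exp (r : R) : 0 <= r -> finite_mean P V (fun v => r ^+ j2 v).
Proof. exact: brownian_bound_exp_moment. Qed.

Let m1 := Num.bound sigma1.
Let m2 := Num.bound sigma2.

Let m1_ge : sigma1 <= m1%:R.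
Proof. exact/ltW/archi_boundP. Qed.

Let m2_ge : sigma2 <= m2%:R.
Proof. exact/ltW/archi_boundP. Qed.

(** The successor makes up for the weak inequality in [ruin_time_attained]. *)
Let k1 v := (m1 * j1 v).+1.
Let k2 v := (m2 * j2 v).+1.
Let k12 v := (k1 v + k2 v)%N.

Let k1_exp : forall r : R, 0 <= r -> finite_mean P V (fun v => r ^+ k1 v).
Proof. exact: exp_affine. Qed.

Let k2_exp : forall r : R, 0 <= r -> finite_mean P V (fun v => r ^+ k2 v).
Proof. exact: exp_affine. Qed.

Let k12_exp : forall r : R, 0 <= r -> finite_mean P V (fun v => r ^+ k12 v).
Proof.
move=> r r0; apply: (@le_lt_trans _ _
  (\int[P]_w ((r ^+ 2) ^+ k1 (V w) + (r ^+ 2) ^+ k2 (V w))%:E)%E).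
  apply: ge0_le_integral => //.
  - by move=> w _; rewrite lee_fin exprn_ge0.
  - by apply/measurable_EFinP; exact: (measurable_discrete mV (fun v => r ^+ k12 v)).
  - apply/measurable_EFinP.
    exact: (measurable_discrete mV (fun v => (r ^+ 2) ^+ k1 v + (r ^+ 2) ^+ k2 v)).
  - move=> w _; rewrite lee_fin exprD ![(r ^+ 2) ^+ _]exprAC.
    by apply: mul_le_sqrD; rewrite exprn_ge0.
apply: (finite_meanD mV (f := fun v => (r ^+ 2) ^+ k1 v)
  (g := fun v => (r ^+ 2) ^+ k2 v)) => [v|v||]; rewrite ?exprn_ge0//.
  by apply: k1_exp; exact: exprn_ge0.
by apply: k2_exp; exact: exprn_ge0.
Qed.

Let fine_scale (c : R) (x : \bar R) : 0 < c -> fine (c%:E * x)%E = c * fine x.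
Proof.
by move=> c0; case: x => [r| |] //; rewrite ?gt0_muley ?gt0_muleNy ?lte_fin//= mulr0.
Qed.

Let exceed (Y : nat -> Omega -> R) (s : index -> R) (u : R) : set Omega :=
  [set w | u + s (V w) < Y (N T w) w].

Let exceedE Y s u : exceed Y s u =
  [set w | (fun v => Y (n v) @^-1` `]u + s v, +oo[%classic) (V w) w].
Proof. by apply/seteqP; split => w; rewrite /exceed /= in_itv/= andbT. Qed.

Let measurable_exceed Y s u : (forall k, measurable_fun setT (Y k)) ->
  measurable (exceed Y s u).
Proof.
move=> mY; rewrite exceedE.
apply: (measurable_discrete_event mV
  (A := fun v => Y (n v) @^-1` `]u + s v, +oo[%classic)) => v.
by rewrite -[X in measurable X]setTI; exact: mY.
Qed.

Let indep_tail (Y : nat -> Omega -> R) (F : probability R R) :=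
  forall k v (x : R), (P (Y k @^-1` `]x, +oo[ `&` V @^-1` [set v]) =
    (tail (conv_pow F k) x)%:E * P (V @^-1` [set v]))%E.

Let pr_exceed (Y : nat -> Omega -> R) (F : probability R R) s u :
  (forall k, measurable_fun setT (Y k)) ->
  indep_tail Y F -> 0 < tail F u ->
  pr P (exceed Y s u) =
  tail F u * fine (\int[P]_w (shifted_ratio n F s u (V w))%:E)%E.
Proof.
move=> mY YV Fu; rewrite exceedE.
pose A v := Y (n v) @^-1` `](u + s v)%R, +oo[%classic.
rewrite (_ : [set w | _] = [set w | A (V w) w])//.
rewrite (mixture (V := V) (A := A)
  (a := fun v => (tail F u)%:E * (shifted_ratio n F s u v)%:E)%E)//.
- rewrite ge0_integralZl_EFin ?(ltW Fu)// ?fine_scale//.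
  + by move=> w _; rewrite lee_fin shifted_ratio_ge0.
  + apply/measurable_EFinP.
    exact: (measurable_discrete mV (shifted_ratio n F s u)).
- by move=> v; rewrite -[X in measurable X]setTI; exact: mY.
- by move=> v; rewrite -EFinM lee_fin mulr_ge0 ?shifted_ratio_ge0// ltW.
- move=> v; rewrite YV -EFinM; congr (_%:E * _)%E.
  by rewrite /shifted_ratio mulrC divfK// gt_eqF.
Qed.

Let exceed_cvg (Y : nat -> Omega -> R) (F : probability R R) s b :
  (forall k, measurable_fun setT (Y k)) ->
  indep_tail Y F ->
  subexponential F -> (forall v, - (b v)%:R <= s v) ->
  (forall r : R, 0 <= r -> finite_mean P V (fun v => r ^+ b v)) ->
  pr P (exceed Y s u) / tail F u @[u --> +oo] --> mu.
Proof.
move=> mY YV Fsub sb bexp; have [_ Fpos _] := Fsub.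
have := random_sum_cvg mV n_exp Fsub sb bexp.
rewrite (poisson_mean mu0 mN PN) /=; apply: cvg_trans; apply: near_eq_cvg.
by apply: nearW => u; rewrite (pr_exceed _ mY YV)// mulrAC divff ?mul1r// gt_eqF.
Qed.

Let exceed2 s1 s2 (u : R * R) := exceed S1 s1 u.1 `&` exceed S2 s2 u.2.

Let pr_exceed2 s1 s2 u : 0 < tail F1 u.1 -> 0 < tail F2 u.2 ->
  pr P (exceed2 s1 s2 u) = tail F1 u.1 * tail F2 u.2 *
    fine (\int[P]_w (shifted_ratio n F1 s1 u.1 (V w) *
                     shifted_ratio n F2 s2 u.2 (V w))%:E)%E.
Proof.
move=> t1 t2; rewrite /exceed2 !exceedE.
have t12 : 0 < tail F1 u.1 * tail F2 u.2 by exact: mulr_gt0.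
pose A v := S1 (n v) @^-1` `]u.1 + s1 v, +oo[%classic `&`
   S2 (n v) @^-1` `]u.2 + s2 v, +oo[%classic.
rewrite (_ : _ `&` _ = [set w | A (V w) w])//.
pose rr v := shifted_ratio n F1 s1 u.1 v * shifted_ratio n F2 s2 u.2 v.
rewrite (mixture (V := V) (A := A) (a := fun v => (tail F1 u.1 * tail F2 u.2)%:E * (rr v)%:E)%E)//.
- rewrite ge0_integralZl_EFin ?(ltW t12)// ?fine_scale//.
  + by move=> w _; rewrite lee_fin mulr_ge0// shifted_ratio_ge0.
  + by apply/measurable_EFinP; exact: (measurable_discrete mV rr).
- by move=> v; apply: measurableI; rewrite -[X in measurable X]setTI; [exact: mS1|exact: mS2].
- move=> v; rewrite -EFinM lee_fin; apply: mulr_ge0; first exact: ltW.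
  by apply: mulr_ge0; exact: shifted_ratio_ge0.
- move=> v; rewrite S_indepV// !tail_gt -!EFinM; congr (_%:E * _)%E.
  rewrite /rr /shifted_ratio mulrACA [_ * (_ / tail F1 u.1)]mulrC divfK ?gt_eqF//.
  by rewrite [_ * (_ / tail F2 u.2)]mulrC divfK// gt_eqF.
Qed.

Let exceed2_cvg s1 s2 b1' b2' : subexponential F1 -> subexponential F2 ->
  (forall v, - (b1' v)%:R <= s1 v) -> (forall v, - (b2' v)%:R <= s2 v) ->
  (forall r : R, 0 <= r -> finite_mean P V (fun v => r ^+ b1' v)) ->
  (forall r : R, 0 <= r -> finite_mean P V (fun v => r ^+ b2' v)) ->
  pr P (exceed2 s1 s2 u) / (tail F1 u.1 * tail F2 u.2) @[u --> both_pinfty R]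
    --> mu * (1 + mu).
Proof.
move=> F1sub F2sub sb1 sb2 be1 be2; have [_ F1pos _] := F1sub.
have [_ F2pos _] := F2sub.
have := random_sum2_cvg mV n_exp F1sub F2sub sb1 sb2 be1 be2.
rewrite (poisson_mean_sqr mu0 mN PN) /=; apply: cvg_trans; apply: near_eq_cvg.
apply: nearW => u; rewrite pr_exceed2// mulrAC divff ?mul1r//.
by rewrite gt_eqF// mulr_gt0.
Qed.

Let U1 u := surplus u C1 X1 N sigma1 B1.
Let U2 u := surplus u C2 X2 N sigma2 B2.

Let X1_ge0 k w : 0 <= X1 k w. Proof. by have [] := X_ge0 k w. Qed.
Let X2_ge0 k w : 0 <= X2 k w. Proof. by have [] := X_ge0 k w. Qed.

(** Levels shifted by [up1], [up2] are necessarily exceeded in case of ruin, and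
    exceeding the levels shifted by [lo1], [lo2] suffices for it. *)
Let up1 v : R := - (k1 v)%:R.
Let up2 v : R := - (k2 v)%:R.
Let lo1 v : R := (i1 v).+1%:R + m1%:R * (j1 v)%:R.
Let lo2 v : R := (i2 v).+1%:R + m2%:R * (j2 v)%:R.

Let up1_ge v : - (k1 v)%:R <= up1 v. Proof. exact: lexx. Qed.
Let up2_ge v : - (k2 v)%:R <= up2 v. Proof. exact: lexx. Qed.
Let up12_ge v : - (k12 v)%:R <= up1 v + up2 v.
Proof. by rewrite /k12 natrD opprD. Qed.

Let lo_ge m i j (k : nat) : - k%:R <= (i.+1%:R + m%:R * j%:R : R).
Proof. by rewrite (@le_trans _ _ 0)// ?oppr_le0// addr_ge0// mulr_ge0. Qed.

Let lo1_ge v : - (k1 v)%:R <= lo1 v. Proof. exact: lo_ge. Qed.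
Let lo2_ge v : - (k2 v)%:R <= lo2 v. Proof. exact: lo_ge. Qed.
Let lo12_ge v : - (k12 v)%:R <= lo1 v + lo2 v.
Proof. by rewrite /k12 natrD opprD; apply: lerD. Qed.

Let premium_le (C : R -> {RV P >-> R}) w : premium_process C ->
  C T w <= (Num.truncn (C T w)).+1%:R.
Proof. by move=> [_ C0 _ _]; have /andP[_ /ltW] := truncn_itv (C0 w T (ltW T0)). Qed.

Let claims_ge1 u w t : 0 < t <= T -> u + up1 (V w) + 1 - U1 u t w <= S1 (N T w) w.
Proof.
move=> tT; have := claims_ge_surplus u C1_premium N_poisson X1_ge0 sigma1_ge0 tT
  (fun s => @brownian_boundP _ _ _ _ _ BM1 _ T0 w s).
apply: le_trans; rewrite /U1 lerD2r /up1 /k1 -natr1 natrM.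
have : sigma1 * (j1 (V w))%:R <= m1%:R * (j1 (V w))%:R by rewrite ler_wpM2r.
by rewrite -/(b1 w) /j1 /=; lra.
Qed.

Let claims_ge2 u w t : 0 < t <= T -> u + up2 (V w) + 1 - U2 u t w <= S2 (N T w) w.
Proof.
move=> tT; have := claims_ge_surplus u C2_premium N_poisson X2_ge0 sigma2_ge0 tT
  (fun s => @brownian_boundP _ _ _ _ _ BM2 _ T0 w s).
apply: le_trans; rewrite /U2 lerD2r /up2 /k2 -natr1 natrM.
have : sigma2 * (j2 (V w))%:R <= m2%:R * (j2 (V w))%:R by rewrite ler_wpM2r.
by rewrite -/(b2 w) /j2 /=; lra.
Qed.

Let T_itv : 0 <= T <= T. Proof. by rewrite lexx ltW. Qed.

Let surplus_le1 u w : U1 u T w <= u + lo1 (V w) - S1 (N T w) w.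
Proof.
have := surplus_le_claims u X1 N sigma1_ge0 (@brownian_boundP _ _ _ _ _ BM1 _ T0 w _ T_itv)
  (premium_le w C1_premium).
move/le_trans; apply; rewrite lerD2r /lo1 addrA lerD2l.
by rewrite ler_wpM2r.
Qed.

Let surplus_le2 u w : U2 u T w <= u + lo2 (V w) - S2 (N T w) w.
Proof.
have := surplus_le_claims u X2 N sigma2_ge0 (@brownian_boundP _ _ _ _ _ BM2 _ T0 w _ T_itv)
  (premium_le w C2_premium).
move/le_trans; apply; rewrite lerD2r /lo2 addrA lerD2l.
by rewrite ler_wpM2r.
Qed.

Let rc1 u : right_continuous_paths (U1 u).
Proof. exact: surplus_right_continuous C1_premium N_poisson BM1. Qed.
Let rc2 u : right_continuous_paths (U2 u).
Proof. exact: surplus_right_continuous C2_premium N_poisson BM2. Qed.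

Let mU1 u t : measurable_fun setT (U1 u t). Proof. exact: measurable_surplus. Qed.
Let mU2 u t : measurable_fun setT (U2 u t). Proof. exact: measurable_surplus. Qed.

Let rmax (u : R * R) := [set w | (T_max (U1 u.1) (U2 u.2) w <= T%:E)%E].
Let rmin (u : R * R) := [set w | (T_min (U1 u.1) (U2 u.2) w <= T%:E)%E].
Let rsum (u : R * R) := [set w | (T_sum (U1 u.1) (U2 u.2) w <= T%:E)%E].

Let rc_max u : right_continuous_paths
  (fun t w => Num.max (U1 u.1 t w) (U2 u.2 t w)).
Proof. by move=> w t t0; apply: cvgr_max; [exact: rc1|exact: rc2]. Qed.

Let rc_min u : right_continuous_paths
  (fun t w => Num.min (U1 u.1 t w) (U2 u.2 t w)).
Proof. by move=> w t t0; apply: cvgr_min; [exact: rc1|exact: rc2]. Qed.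

Let rc_sum u : right_continuous_paths (fun t w => U1 u.1 t w + U2 u.2 t w).
Proof. by move=> w t t0; apply: cvgD; [exact: rc1|exact: rc2]. Qed.

Let mrmax u : measurable (rmax u).
Proof.
by apply: (measurable_ruin_time (@rc_max u) T0) => t _; exact: measurable_maxr.
Qed.

Let mrmin u : measurable (rmin u).
Proof.
by apply: (measurable_ruin_time (@rc_min u) T0) => t _; exact: measurable_minr.
Qed.

Let mrsum u : measurable (rsum u).
Proof.
by apply: (measurable_ruin_time (@rc_sum u) T0) => t _; exact: measurable_funD.
Qed.

Let mex1 s u : measurable (exceed S1 s u). Proof. exact: measurable_exceed. Qed.
Let mex2 s u : measurable (exceed S2 s u). Proof. exact: measurable_exceed. Qed.
Let mSZ k : measurable_fun setT (SZ k).
Proof. by apply: measurable_sum => i; exact: measurable_funD. Qed.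
Let mexZ s u : measurable (exceed SZ s u). Proof. exact: measurable_exceed. Qed.

Let rmax_sub u : rmax u `<=` exceed2 up1 up2 u.
Proof.
move=> w /(ruin_time_attained (@rc_max u) T0)[t [tT]]; rewrite ge_max => /andP[u1 u2].
have := claims_ge1 u.1 w tT; have := claims_ge2 u.2 w tT.
by rewrite /exceed2 /exceed /=; split; lra.
Qed.

Let rmax_sup u : exceed2 lo1 lo2 u `<=` rmax u.
Proof.
move=> w [e1 e2]; apply: ruin_time_lt => //; rewrite gt_max.
have := surplus_le1 u.1 w; have := surplus_le2 u.2 w.
by move: e1 e2; rewrite /exceed /=; lra.
Qed.

Let rmin_sub u : rmin u `<=` exceed S1 up1 u.1 `|` exceed S2 up2 u.2.
Proof.
move=> w /(ruin_time_attained (@rc_min u) T0)[t [tT]]; rewrite ge_min => /orP[u1|u2].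
  by left; have := claims_ge1 u.1 w tT; rewrite /exceed /=; lra.
by right; have := claims_ge2 u.2 w tT; rewrite /exceed /=; lra.
Qed.

Let rmin_sup u : exceed S1 lo1 u.1 `|` exceed S2 lo2 u.2 `<=` rmin u.
Proof.
move=> w e; apply: ruin_time_lt => //; rewrite gt_min; apply/orP.
case: e => e; [left; have := surplus_le1 u.1 w|right; have := surplus_le2 u.2 w];
  by move: e; rewrite /exceed /=; lra.
Qed.

Let rsum_sub u : rsum u `<=` exceed SZ (fun v => up1 v + up2 v) (u.1 + u.2).
Proof.
move=> w /(ruin_time_attained (@rc_sum u) T0)[t [tT ut]].
have := claims_ge1 u.1 w tT; have := claims_ge2 u.2 w tT.
by rewrite /exceed /= SE; lra.
Qed.

Let rsum_sup u : exceed SZ (fun v => lo1 v + lo2 v) (u.1 + u.2) `<=` rsum u.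
Proof.
move=> w e; apply: ruin_time_lt => //.
have := surplus_le1 u.1 w; have := surplus_le2 u.2 w.
by move: e; rewrite /exceed /= SE; lra.
Qed.

Let psi_max u := pr P (rmax u).
Let psi_min u := pr P (rmin u).
Let psi_sum u := pr P (rsum u).

Let S1_tail : indep_tail S1 F1. Proof. exact: S1V. Qed.
Let S2_tail : indep_tail S2 F2. Proof. exact: S2V. Qed.
Let SZ_tail : indep_tail SZ H. Proof. exact: SZV. Qed.

Let mex12 s1 s2 u : measurable (exceed2 s1 s2 u).
Proof. exact: measurableI. Qed.

(** The limit of the joint exceedance does not depend on the shifts, so the necessary
    and the sufficient condition squeeze the ruin probability. *)
Lemma psi_max_equiv : subexponential F1 -> subexponential F2 ->
  asymp_equiv (both_pinfty R) psi_max
    (fun u => mu * (1 + mu) * tail F1 u.1 * tail F2 u.2).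
Proof.
move=> F1sub F2sub; have [_ F1pos _] := F1sub; have [_ F2pos _] := F2sub.
have m0 : 0 < mu * (1 + mu) by rewrite mulr_gt0// addr_gt0.
pose g s1 s2 u := pr P (exceed2 s1 s2 u) / (tail F1 u.1 * tail F2 u.2) / (mu * (1 + mu)).
have glim s1 s2 : pr P (exceed2 s1 s2 u) / (tail F1 u.1 * tail F2 u.2)
    @[u --> both_pinfty R] --> mu * (1 + mu) -> g s1 s2 u @[u --> both_pinfty R] --> (1 : R).
  move=> h; rewrite -(divff (lt0r_neq0 m0)).
  by apply: cvgM => //; exact: cvg_cst.
apply: (@squeeze_cvgr _ _ _ _ (g lo1 lo2) (g up1 up2)).
- apply: nearW => u; have t1 := F1pos u.1; have t2 := F2pos u.2.
  have -> x : x / (mu * (1 + mu) * tail F1 u.1 * tail F2 u.2) =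
      x / (tail F1 u.1 * tail F2 u.2) / (mu * (1 + mu)).
    by rewrite -mulrA -[in RHS]mulrA -invfM [mu * _ * _]mulrC.
  have t12 : 0 < tail F1 u.1 * tail F2 u.2 by exact: mulr_gt0.
  rewrite /g !ler_pM2r ?invr_gt0//; apply/andP; split.
    by apply: pr_mono => //; exact: rmax_sup.
  by apply: pr_mono => //; exact: rmax_sub.
- by apply: glim; exact: (exceed2_cvg F1sub F2sub lo1_ge lo2_ge k1_exp k2_exp).
- by apply: glim; exact: (exceed2_cvg F1sub F2sub up1_ge up2_ge k1_exp k2_exp).
Qed.

Let fst_pinfty : u.1 @[u --> both_pinfty R] --> +oo.
Proof. exact: cvg_fst. Qed.

Let snd_pinfty : u.2 @[u --> both_pinfty R] --> +oo.
Proof. exact: cvg_snd. Qed.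

(** The probability that some line is ruined is bounded from above by the sum of the two
    exceedance probabilities, and from below by inclusion and exclusion; the joint exceedance is
    of the order of the product of the tails. *)
Lemma psi_min_equiv : subexponential F1 -> subexponential F2 ->
  asymp_equiv (both_pinfty R) psi_min
    (fun u => mu * (tail F1 u.1 + tail F2 u.2)).
Proof.
move=> F1sub F2sub; have [_ F1pos _] := F1sub; have [_ F2pos _] := F2sub.
pose a1 s (u : R * R) := pr P (exceed S1 s u.1) / tail F1 u.1.
pose a2 s (u : R * R) := pr P (exceed S2 s u.2) / tail F2 u.2.
have a1lim s : (forall v, - (k1 v)%:R <= s v) -> a1 s u @[u --> both_pinfty R] --> mu.
  move=> sk; apply: (cvg_comp (fun u : R * R => u.1)
    (fun x => pr P (exceed S1 s x) / tail F1 x) fst_pinfty).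
  exact: (exceed_cvg mS1 S1_tail F1sub sk k1_exp).
have a2lim s : (forall v, - (k2 v)%:R <= s v) -> a2 s u @[u --> both_pinfty R] --> mu.
  move=> sk; apply: (cvg_comp (fun u : R * R => u.2)
    (fun x => pr P (exceed S2 s x) / tail F2 x) snd_pinfty).
  exact: (exceed_cvg mS2 S2_tail F2sub sk k2_exp).
pose e u := pr P (exceed2 lo1 lo2 u) / (tail F1 u.1 * tail F2 u.2) * tail F1 u.1.
have elim : e u @[u --> both_pinfty R] --> (0 : R).
  rewrite -(mulr0 (mu * (1 + mu))); apply: cvgM.
    exact: (exceed2_cvg F1sub F2sub lo1_ge lo2_ge k1_exp k2_exp).
  exact: (cvg_comp (fun u : R * R => u.1) (tail F1) fst_pinfty (tail_cvg0 F1)).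
pose lo u := (mu - `|a1 lo1 u - mu| - `|a2 lo2 u - mu| - e u) / mu.
pose up u := (mu + `|a1 up1 u - mu| + `|a2 up2 u - mu|) / mu.
have dist0 (f : R * R -> R) : f u @[u --> both_pinfty R] --> mu ->
    `|f u - mu| @[u --> both_pinfty R] --> (0 : R).
  move=> fm; rewrite -(normr0 R) -(subrr mu); apply: cvg_norm.
  by apply: cvgB => //; exact: cvg_cst.
apply: (@squeeze_cvgr _ _ _ _ lo up).
- apply: nearW => u; have t1 := F1pos u.1; have t2 := F2pos u.2.
  have t12 : 0 < tail F1 u.1 + tail F2 u.2 by exact: addr_gt0.
  have pE1 s : pr P (exceed S1 s u.1) = a1 s u * tail F1 u.1.
    by rewrite /a1 divfK// gt_eqF.
  have pE2 s : pr P (exceed S2 s u.2) = a2 s u * tail F2 u.2.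
    by rewrite /a2 divfK// gt_eqF.
  have pe : pr P (exceed2 lo1 lo2 u) = e u * tail F2 u.2.
    by rewrite /e -mulrA divfK// mulf_neq0// gt_eqF.
  have e0 : 0 <= e u by rewrite !mulr_ge0 ?pr_ge0 ?invr_ge0 ?mulr_ge0// ltW.
  have -> x : x / (mu * (tail F1 u.1 + tail F2 u.2)) =
      x / (tail F1 u.1 + tail F2 u.2) / mu by rewrite invfM [mu^-1 * _]mulrC mulrA.
  rewrite /lo /up !ler_pM2r ?invr_gt0// ler_pdivlMr// ler_pdivrMr//.
  have lb : a1 lo1 u * tail F1 u.1 + a2 lo2 u * tail F2 u.2 - e u * tail F2 u.2 <= psi_min u.
    rewrite -pE1 -pE2 -pe -prUI; [|exact: mex1|exact: mex2].
    by apply: pr_mono; [exact: measurableU|exact: mrmin|exact: rmin_sup].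
  have ub : psi_min u <= a1 up1 u * tail F1 u.1 + a2 up2 u * tail F2 u.2.
    rewrite -pE1 -pE2; apply: le_trans (prU_le P (mex1 _ _) (mex2 _ _)).
    by apply: pr_mono; [exact: mrmin|exact: measurableU|exact: rmin_sub].
  apply/andP; split.
    by apply: le_trans lb; apply: weighted_lower => //; exact: ltW.
  by apply: (le_trans ub); apply: weighted_upper; exact: ltW.
- rewrite [X in _ --> X](_ : 1 = (mu - 0 - 0 - 0) / mu); last first.
    by rewrite !subr0 divff// gt_eqF.
  apply: cvgM; last exact: cvg_cst.
  apply: cvgB => //; apply: cvgB; last by apply: dist0; exact: a2lim.
  by apply: cvgB; [exact: cvg_cst|apply: dist0; exact: a1lim].
- rewrite [X in _ --> X](_ : 1 = (mu + 0 + 0) / mu); last first.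
    by rewrite !addr0 divff// gt_eqF.
  apply: cvgM; last exact: cvg_cst.
  apply: cvgD; last by apply: dist0; exact: a2lim.
  by apply: cvgD; [exact: cvg_cst|apply: dist0; exact: a1lim].
Qed.

Let sum_to_pinfty : u.1 + u.2 @[u --> sum_pinfty R] --> +oo.
Proof.
by move=> A [M [_ MA]]; exists M => // u; exact: MA.
Qed.

Let F_ge0 (X : {RV P >-> R}) : (forall w, 0 <= X w) ->
  distribution P X `]-oo, 0[%classic = 0%E.
Proof.
move=> X0; rewrite /distribution /pushforward (_ : _ @^-1` _ = set0) ?measure0//.
by apply/seteqP; split => // w /=; rewrite in_itv/= ltNge X0.
Qed.

(** The two lines together form one line with claims [X1 k + X2 k] of law [H], and
    [tail_convolution_equiv] splits the tail of [H]. *)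
Lemma psi_sum_equiv : subexponential H ->
  asymp_equiv (sum_pinfty R) psi_sum
    (fun u => mu * (tail F1 (u.1 + u.2) + tail F2 (u.1 + u.2))).
Proof.
move=> Hsub; have [_ Hpos _] := Hsub.
have FH := tail_convolution_equiv (F_ge0 (X1_ge0 0)) (F_ge0 (X2_ge0 0)) Hsub.
have HF : tail H x / (tail F1 x + tail F2 x) @[x --> +oo] --> (1 : R).
  have h3 : ((tail F1 x + tail F2 x) / tail H x)^-1 @[x --> +oo] --> (1 : R).
    by rewrite -[1]invr1; apply: cvgV.
  apply: cvg_trans h3; apply: near_eq_cvg; apply: nearW => x.
  by rewrite invf_div.
pose g s x := pr P (exceed SZ s x) / tail H x * (tail H x / (tail F1 x + tail F2 x)) / mu.
have glim s : (forall v, - (k12 v)%:R <= s v) ->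
    g s (u.1 + u.2) @[u --> sum_pinfty R] --> (1 : R).
  move=> sk; have : g s x @[x --> +oo] --> mu * 1 / mu.
    apply: cvgM; last exact: cvg_cst.
    by apply: cvgM => //; exact: (exceed_cvg mSZ SZ_tail Hsub sk k12_exp).
  rewrite mulr1 divff ?gt_eqF// => gs.
  exact: (cvg_comp (fun u : R * R => u.1 + u.2) (g s) sum_to_pinfty gs).
apply: (@squeeze_cvgr _ _ _ _ (fun u => g (fun v => lo1 v + lo2 v) (u.1 + u.2))
  (fun u => g (fun v => up1 v + up2 v) (u.1 + u.2))).
- apply: nearW => u; have t := Hpos (u.1 + u.2).
  set x := u.1 + u.2.
  have gE s : g s x = pr P (exceed SZ s x) / (mu * (tail F1 x + tail F2 x)).
    by rewrite /g mulrA divfK ?gt_eqF// -mulrA -invfM [_ * mu]mulrC.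
  rewrite !gE; have d0 : 0 <= (mu * (tail F1 x + tail F2 x))^-1.
    by rewrite invr_ge0 mulr_ge0 ?(ltW mu0)// addr_ge0 ?tail_ge0.
  apply/andP; split; apply: ler_wpM2r => //.
    by apply: pr_mono => //; exact: rsum_sup.
  by apply: pr_mono => //; exact: rsum_sub.
- exact: glim.
- exact: glim.
Qed.

End risk_model.

Theorem theorem4p1 (R : realType) (d : measure_display)
    (Omega : measurableType d) (P : probability Omega R)
    (lambda rho sigma1 sigma2 : R)
    (X1 X2 : nat -> {RV P >-> R})
    (C1 C2 : R -> {RV P >-> R})
    (N : R -> {RV P >-> nat})
    (B1 B2 : R -> {RV P >-> R})
    (lambda_gt0 : 0 < lambda)
    (rho_bounds : -1 < rho <= 0)
    (sigma1_ge0 : 0 <= sigma1) (sigma2_ge0 : 0 <= sigma2)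
    (X_ge0 : forall k omega, 0 <= X1 k omega /\ 0 <= X2 k omega)
    (X_iid : iid P (fun k omega => (X1 k omega, X2 k omega)))
    (C1_premium : premium_process C1) (C2_premium : premium_process C2)
    (N_poisson : poisson_process lambda N)
    (B_brownian : brownian_motion2 rho B1 B2)
    (loading1 : safety_loading lambda C1 (X1 0%N))
    (loading2 : safety_loading lambda C2 (X2 0%N))
    (indep : mutual_indep P (fun i : 'I_6 => nth set0
      [:: sigma_process [set: nat] (fun k omega => X1 k omega);
          sigma_process [set: nat] (fun k omega => X2 k omega);
          sigma_process [set t : R | 0 <= t] (fun t omega => C1 t omega);
          sigma_process [set t : R | 0 <= t] (fun t omega => C2 t omega);
          sigma_process [set t : R | 0 <= t] (fun t omega => N t omega);
          sigma_process [set t : R | 0 <= t]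
            (fun t omega => (B1 t omega, B2 t omega))] i)) :
  let F1 : probability R R := distribution P (X1 0%N) in
  let F2 : probability R R := distribution P (X2 0%N) in
  let U1 (u : R * R) := surplus u.1 C1 X1 N sigma1 B1 in
  let U2 (u : R * R) := surplus u.2 C2 X2 N sigma2 B2 in
  let psi_max (u : R * R) (T : R) := ruin_prob P (T_max (U1 u) (U2 u)) T in
  let psi_min (u : R * R) (T : R) := ruin_prob P (T_min (U1 u) (U2 u)) T in
  let psi_sum (u : R * R) (T : R) := ruin_prob P (T_sum (U1 u) (U2 u)) T in
  (subexponential F1 -> subexponential F2 -> forall T : R, 0 < T ->
    asymp_equiv (both_pinfty R) (fun u => psi_max u T)
      (fun u => lambda * T * (1 + lambda * T) * tail F1 u.1 * tail F2 u.2) /\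
    asymp_equiv (both_pinfty R) (fun u => psi_min u T)
      (fun u => lambda * T * (tail F1 u.1 + tail F2 u.2))) /\
  (subexponential (convolution F1 F2) -> forall T : R, 0 < T ->
    asymp_equiv (sum_pinfty R) (fun u => psi_sum u T)
      (fun u => lambda * T * (tail F1 (u.1 + u.2) + tail F2 (u.1 + u.2)))).
Proof.
have [BM1 BM2 _ _] := B_brownian.
move=> F1 F2 U1 U2 psi_max psi_min psi_sum; split.
  move=> F1sub F2sub T T0; split.
    exact: (psi_max_equiv lambda_gt0 sigma1_ge0 sigma2_ge0 X_ge0 X_iid
      C1_premium C2_premium N_poisson BM1 BM2 indep T0 F1sub F2sub).
  exact: (psi_min_equiv lambda_gt0 sigma1_ge0 sigma2_ge0 X_ge0 X_iid
    C1_premium C2_premium N_poisson BM1 BM2 indep T0 F1sub F2sub).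
move=> Hsub T T0.
exact: (psi_sum_equiv lambda_gt0 sigma1_ge0 sigma2_ge0 X_ge0 X_iid
  C1_premium C2_premium N_poisson BM1 BM2 indep T0 Hsub).
Qed.
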